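(* Let $\mathbf{Y}=\boldsymbol{\xi}+\boldsymbol{\omega}(\boldsymbol{\delta}U+\mathbf{Z})\sim\mathcal{MMNE}_p(\boldsymbol{\xi},\mathbf{\Omega},\boldsymbol{\delta})$ with $\boldsymbol{\delta}\neq\mathbf{0}$, where $U$ is standard exponential. Put $\mathbf{\Sigma}_{\mathbf{Y}}=\mathbf{\Omega}-\boldsymbol{\omega}\boldsymbol{\delta}\boldsymbol{\delta}^\top\boldsymbol{\omega}$, $\eta=\sqrt{\boldsymbol{\delta}^\top\boldsymbol{\omega}\mathbf{\Sigma}_{\mathbf{Y}}^{-1}\boldsymbol{\omega}\boldsymbol{\delta}}$ and, for $\mathbf{y}\in\mathbb{R}^p$, $A=A(\mathbf{y})=\eta^{-1}[\boldsymbol{\delta}^\top\boldsymbol{\omega}\mathbf{\Sigma}_{\mathbf{Y}}^{-1}(\mathbf{y}-\boldsymbol{\xi})-1]$. Then the conditional distribution of $U$ given $\mathbf{Y}=\mathbf{y}$ is $\mathcal{TN}(\eta^{-1}A,\eta^{-2},(0,\infty))$. Furthermore, $$\mathrm{E}[U\mid\mathbf{Y}=\mathbf{y}]=\eta^{-1}\Big(A+\frac{\phi(A)}{\Phi(A)}\Big),$$ and for $k\in\{2,3,\dots\}$, $$\mathrm{E}[U^k\mid\mathbf{Y}=\mathbf{y}]=A\eta^{-1}\,\mathrm{E}[U^{k-1}\mid\mathbf{Y}=\mathbf{y}]+(k-1)\eta^{-2}\,\mathrm{E}[U^{k-2}\mid\mathbf{Y}=\mathbf{y}].$$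
   Context: Let $\boldsymbol{\xi}\in\mathbb{R}^p$, $\mathbf{\Omega}$ a $p\times p$ symmetric positive definite matrix, $\boldsymbol{\omega}=\mathrm{diag}(\mathbf{\Omega}_{11}^{1/2},\dots,\mathbf{\Omega}_{pp}^{1/2})$, $\overline{\mathbf{\Omega}}=\boldsymbol{\omega}^{-1}\mathbf{\Omega}\boldsymbol{\omega}^{-1}$, $\boldsymbol{\delta}\in\mathbb{R}^p$ with $\overline{\mathbf{\Omega}}-\boldsymbol{\delta}\boldsymbol{\delta}^\top$ positive definite. $\mathcal{MMNE}_p(\boldsymbol{\xi},\mathbf{\Omega},\boldsymbol{\delta})$ denotes the law of $\boldsymbol{\xi}+\boldsymbol{\omega}(\boldsymbol{\delta}U+\mathbf{Z})$ where $U$ has density $e^{-u}$, $u>0$, and $\mathbf{Z}\sim\mathcal{N}_p(\mathbf{0},\overline{\mathbf{\Omega}}-\boldsymbol{\delta}\boldsymbol{\delta}^\top)$ is independent of $U$. $\mathcal{TN}(a,b,(0,\infty))$ is the normal distribution with mean $a$ and variance $b$ truncated to $(0,\infty)$. $\phi$ and $\Phi$ are the standard normal density and CDF. *)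

(* Defs.v *)
From HB Require Import structures.
From mathcomp Require Import all_boot all_order all_algebra.
From mathcomp Require Import all_classical all_reals all_analysis.
Set Implicit Arguments. Unset Strict Implicit. Unset Printing Implicit Defensive.
Import Order.TTheory GRing.Theory Num.Theory.
Import numFieldNormedType.Exports.
Local Open Scope classical_set_scope.
Local Open Scope ring_scope.

Section defs.
Context {R : realType}.

Definition sc (M : 'M[R]_1) : R := M ord0 ord0.

Definition spd (p : nat) (M : 'M[R]_p) : Prop :=
  M^T = M /\ forall x : 'cV[R]_p, x != 0 -> 0 < sc (x^T *m M *m x).

Definition omega_of (p : nat) (Om : 'M[R]_p) : 'M[R]_p :=
  \matrix_(i, j) (if i == j then Num.sqrt (Om i i) else 0).

Definition Ombar (p : nat) (Om : 'M[R]_p) : 'M[R]_p :=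
  invmx (omega_of Om) *m Om *m invmx (omega_of Om).

Definition SigmaY (p : nat) (Om : 'M[R]_p) (de : 'cV[R]_p) : 'M[R]_p :=
  Om - omega_of Om *m de *m de^T *m omega_of Om.

Definition eta_of (p : nat) (Om : 'M[R]_p) (de : 'cV[R]_p) : R :=
  Num.sqrt (sc (de^T *m omega_of Om *m invmx (SigmaY Om de) *m omega_of Om *m de)).

Definition A_of (p : nat) (xi : 'cV[R]_p) (Om : 'M[R]_p) (de : 'cV[R]_p)
    (y : 'cV[R]_p) : R :=
  (eta_of Om de)^-1 *
  (sc (de^T *m omega_of Om *m invmx (SigmaY Om de) *m (y - xi)) - 1).

Definition std_phi (x : R) : R := normal_pdf 0 1 x.
Definition std_Phi (x : R) : R :=
  fine (\int[@lebesgue_measure R]_(u in `]-oo, x]) (std_phi u)%:E)%E.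

(* density of TN(a, b, (0,oo)): normal with mean a and VARIANCE b, truncated *)
Definition tn_pdf (a b : R) (u : R) : R :=
  if 0 < u then normal_pdf a (Num.sqrt b) u / std_Phi (a / Num.sqrt b) else 0.

Definition tn_prob (a b : R) (B : set R) : \bar R :=
  (\int[@lebesgue_measure R]_(u in B) (tn_pdf a b u)%:E)%E.

Definition tn_moment (a b : R) (k : nat) : \bar R :=
  (\int[@lebesgue_measure R]_(u in [set: R]) ((u ^+ k) * tn_pdf a b u)%:E)%E.

(* The kernel y |-> TN(eta^{-1} A(y), eta^{-2}, (0,oo)) and the conditional
   moments E[U^k | Y = y] := \int u^k K(y, du) *)
Definition cond_kernel (p : nat) (xi : 'cV[R]_p) (Om : 'M[R]_p) (de : 'cV[R]_p)
    (y : 'cV[R]_p) : set R -> \bar R :=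
  tn_prob ((eta_of Om de)^-1 * A_of xi Om de y) ((eta_of Om de) ^- 2).

Definition cond_moment (p : nat) (xi : 'cV[R]_p) (Om : 'M[R]_p) (de : 'cV[R]_p)
    (k : nat) (y : 'cV[R]_p) : \bar R :=
  tn_moment ((eta_of Om de)^-1 * A_of xi Om de y) ((eta_of Om de) ^- 2) k.

Definition rect (p : nat) (C : 'I_p -> set R) : set 'cV[R]_p :=
  [set x | forall i, C i (x i ord0)].

End defs.

(* Main.v *)
(** Put [W = omega^-1 (Y - xi) = U de + Z], [G = Ombar - de de^T],
    [b = G^-1 de] and [S = b . W = eta^2 U + b . Z], so that
    [A(Y) = (S - 1) / eta].  For the pair [(U, S)] Bayes' formula is explicit:
    [e^-u] times the density of [N(eta^2 u, eta^2)] at [S] is, as a function of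
    [u > 0], proportional to the density of [N(A / eta, eta^-2)].

    To pass from [S] to [Y] we use that [S] is sufficient.  Only the laws of the
    projections [a . Z] are given, so this is done with Fourier transforms:
    [E (f(U) cos (a . W + th))] equals
    [E (f(U) cos ((a . de) U + th)) exp (- a^T G a / 2)], and comparing this for
    [a + r b] and [(s + r) b], where [s = (a . de) / eta^2], shows that
    [E (cos (a . W + th) | S)] is a constant multiple of [cos (s S + th)].
    Hence [1_B(U) - K(S, B)] is orthogonal to all [cos (a . W + th)], and so to
    the indicators of all boxes in [Y], by Fourier uniqueness applied one
    coordinate at a time.  In dimension one, uniqueness follows from Gaussian
    smoothing, the Gaussian being its own Fourier transform.

    The moments of the truncated normal law are computed by integrating the
    derivative of [u^k] times the normal density over the half-line. *)

Require Import Defs.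
From HB Require Import structures.
From mathcomp Require Import all_boot all_order all_algebra.
From mathcomp Require Import all_classical all_reals all_analysis.
From mathcomp Require Import measurable_realfun ring lra.
Set Implicit Arguments.
Unset Strict Implicit.
Unset Printing Implicit Defensive.
Import Order.TTheory GRing.Theory Num.Theory.
Import numFieldNormedType.Exports.
Local Open Scope classical_set_scope.
Local Open Scope ring_scope.

(** The vector [b] is singled out by [G b = de]. It makes the covariance of [a . Z] and [b . Z]
    equal to [a . de], which is also the coefficient of [U] in [a . W]. Subtracting [s S] with
    [s = (a . de) / eta^2] therefore removes both at once: the residual [a . W - s S] is free of [U]
    and uncorrelated with [b . Z]. This is why [S] is sufficient, and the constant in front of
    [cos (s S + th)] is [exp (- v / 2)], where [v = a^T G a - s^2 eta^2] is the variance of the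
    residual.

    No joint density of [Z] is given, and independence is given on boxes only, so no conditional
    expectation is ever formed. Everything is phrased as [E (H g(X)) = 0] for a bounded [H] and a
    class of test functions [g], and the work consists in changing the class: indicators, cosines,
    bounded functions, boxes. A free phase [th] in the cosines replaces complex exponentials, since
    [th - pi / 2] yields the sine. *)

Lemma measurable_EFin_comp d (T : measurableType d) (R : realType) (f : T -> R) :
  measurable_fun setT f -> measurable_fun setT (fun x => (f x)%:E).
Proof. by move=> mf; exact/measurable_EFinP. Qed.

Lemma integral_indicM d (R : realType) (T : measurableType d) (m : {measure set T -> \bar R})
    (D : set T) (f : T -> \bar R) :
  (\int[m]_(x in D) f x = \int[m]_x ((\1_D x)%:E * f x))%E.
Proof.
by rewrite integral_mkcond; apply: eq_integral => x _; rewrite epatch_indic muleC.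
Qed.

(** * Affine changes of variable for the Lebesgue integral *)

Section affine_change_of_variables.
Context {R : realType}.
Notation mu := (@lebesgue_measure R).

Lemma measurable_affine (c d : R) :
  measurable_fun [set: measurableTypeR R] (fun x => c * x + d : measurableTypeR R).
Proof. by apply: measurable_funD => //; exact: measurable_funM. Qed.

(** Lebesgue measure is determined by its values on half-open intervals, and there it agrees with
    [c] times its image under [x |-> c * x + d]. *)
Lemma ge0_integral_affine_gt0 (c d : R) (f : R -> \bar R) : 0 < c ->
  measurable_fun setT f -> (forall x, 0 <= f x)%E ->
  (\int[mu]_x f x = c%:E * \int[mu]_x f (c * x + d)%R)%E.
Proof.
move=> c0 mf f0.
pose phi := (fun x => c * x + d) : measurableTypeR R -> measurableTypeR R.
have mphi : measurable_fun setT phi := measurable_affine c d.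
pose nu : {measure set (measurableTypeR R) -> \bar R} :=
  measure_function_pushforward__canonical__measure_function_Measure mu mphi.
pose c' : {nonneg R} := NngNum (ltW c0).
have muE A : measurable A -> mu A = mscale c' nu A.
  move=> mA; apply: lebesgue_measure_unique => //= _ [[a b]] _ <-.
  rewrite /mscale/= /pushforward (_ : _ @^-1` _ = `](a - d) / c, (b - d) / c]%classic);
      last first.
    apply/seteqP; split => x /=; rewrite !in_itv/= ltr_pdivrMr// ler_pdivlMr//;
    by rewrite ltrBlDr lerBrDr mulrC.
  rewrite !lebesgue_measure_itv/= !lte_fin ltr_pM2r ?invr_gt0// ltrD2r.
  case: ifPn => ab; last by rewrite mule0.
  by rewrite -!EFinB -EFinM -mulrBl mulrCA divff ?gt_eqF// mulr1; congr EFin; lra.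
transitivity (\int[mscale c' nu]_x f x)%E.
  by apply: eq_measure_integral => A mA _; exact: muE.
rewrite ge0_integral_mscale//=; congr (_ * _)%E.
exact: ge0_integral_pushforward.
Qed.

Lemma ge0_integral_opp (f : R -> \bar R) :
  measurable_fun setT f -> (forall x, 0 <= f x)%E ->
  (\int[mu]_x f x = \int[mu]_x f (- x)%R)%E.
Proof.
move=> mf f0.
transitivity (\int[pushforward mu (-%R : measurableTypeR R -> measurableTypeR R)]_x f x)%E.
  by apply: eq_measure_integral => A mA _; exact/esym/lebesgue_measureN.
by rewrite ge0_integral_pushforward.
Qed.

End affine_change_of_variables.

(** * Integration against a law given by a density *)

Section density.
Context d (T : measurableType d) (R : realType).
Notation mu := (@lebesgue_measure R).
Variables (m : {measure set T -> \bar R}) (X : T -> R) (q : R -> R).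
Hypotheses (mX : measurable_fun setT X) (mq : measurable_fun setT q)
  (q0 : forall x, 0 <= q x).
Hypothesis mXq : forall A : set R, measurable A ->
  m (X @^-1` A) = (\int[mu]_(x in A) (q x)%:E)%E.

Import HBNNSimple.

(** The hypothesis [mXq] is the case of an indicator. Linearity extends it to simple functions, and
    monotone convergence along [nnsfun_approx] to all nonnegative measurable [f]. *)
Lemma ge0_integral_density (f : R -> \bar R) : measurable_fun setT f ->
  (forall x, 0 <= f x)%E ->
  (\int[m]_t f (X t) = \int[mu]_x (f x * (q x)%:E))%E.
Proof.
move=> mf f0.
have mq' : measurable_fun setT (EFin \o q) by exact/measurable_EFinP.
pose g := nnsfun_approx measurableT mf.
have gf x : EFin \o g ^~ x @ \oo --> f x by exact: cvg_nnsfun_approx.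
have mgE n : measurable_fun setT (EFin \o g n) by exact/measurable_EFinP.
have ndg x : nondecreasing_seq (fun n => (g n x)%:E).
  by move=> i j ij; rewrite lee_fin; exact/lefP/nd_nnsfun_approx.
transitivity (limn (fun n => \int[m]_t (g n (X t))%:E)%E).
  rewrite -monotone_convergence//.
  - by apply: eq_integral => t _; apply/esym/cvg_lim => //; exact: gf.
  - by move=> n; apply/measurable_EFinP; apply: measurableT_comp.
  - by move=> n t _; rewrite lee_fin.
transitivity (limn (fun n => \int[mu]_x ((g n x)%:E * (q x)%:E))%E); last first.
  rewrite -monotone_convergence//.
  - apply: eq_integral => x _; apply/cvg_lim => //.
    by under eq_fun do rewrite muleC; rewrite muleC; apply: cvgeZl => //; exact: gf.
  - by move=> n; exact: (emeasurable_funM (mgE n)).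
  - by move=> n x _; rewrite mule_ge0// lee_fin.
  - by move=> x _ i j ij; apply: lee_wpmul2r; [rewrite lee_fin|exact: ndg].
congr (limn _); apply/funext => n.
have mgk k : measurable (g n @^-1` [set k]) by [].
have m1 k : measurable_fun [set: R] (fun x : R => (\1_(g n @^-1` [set k]) x)%:E : \bar R).
  by apply/measurable_EFinP; exact: measurable_indic.
transitivity (\int[m]_t \sum_(k \in range (g n))
    (k%:E * (\1_(g n @^-1` [set k]) (X t))%:E))%E.
  by apply: eq_integral => t _; rewrite fsumEFin// -fimfunE.
rewrite ge0_integral_fsum//; last 2 first.
- move=> k; apply/measurable_EFinP; apply: measurable_funM => //.
  by apply: measurableT_comp => //; exact: measurable_indic.
- by move=> k t _; exact: nnfun_muleindic_ge0.
transitivity (\int[mu]_x \sum_(k \in range (g n))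
    ((k%:E * (\1_(g n @^-1` [set k]) x)%:E) * (q x)%:E))%E; last first.
  apply: eq_integral => x _.
  rewrite -ge0_mule_fsuml; last by move=> k; exact: nnfun_muleindic_ge0.
  by congr (_ * _)%E; rewrite fsumEFin// -fimfunE.
rewrite ge0_integral_fsum//; last 2 first.
- move=> k; apply: (@emeasurable_funM _ R) => //.
  exact: (measurable_funeM _ (m1 k)).
- by move=> k x _; rewrite mule_ge0 ?lee_fin//; exact: nnfun_muleindic_ge0.
apply: eq_fsbigr => k /[!inE] -[y _ <-].
under [RHS]eq_integral do rewrite -muleA.
rewrite !ge0_integralZl//; last 5 first.
- exact: (emeasurable_funM (m1 _) mq').
- by move=> x _; rewrite mule_ge0 ?lee_fin.
- by rewrite lee_fin.
- apply/measurable_EFinP.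
  by apply: measurableT_comp => //; exact: measurable_indic.
- by rewrite lee_fin.
congr (_ * _)%E.
transitivity (m (X @^-1` (g n @^-1` [set g n y]))).
  rewrite (_ : (fun t => _) = (fun t => (\1_(X @^-1` (g n @^-1` [set g n y])) t)%:E))//.
  rewrite integral_indic ?setIT//.
  by rewrite -[X in measurable X]setTI; exact: mX.
by rewrite mXq// [LHS]integral_indicM.
Qed.

End density.

(** * The normal density: scaling, distribution function, decay, derivative *)

Section gaussian.
Context {R : realType}.
Notation mu := (@lebesgue_measure R).
Implicit Types (a s x : R).

Lemma measurable_EFin_indic (D : set R) : measurable D ->
  measurable_fun [set: R] (fun x : R => (\1_D x)%:E : \bar R).
Proof. by move=> mD; apply/measurable_EFinP; exact: measurable_indic. Qed.

Lemma measurable_EFin_normal_pdf a s :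
  measurable_fun [set: R] (fun x : R => (normal_pdf a s x)%:E : \bar R).
Proof. by apply/measurable_EFinP; exact: measurable_normal_pdf. Qed.

Lemma normal_pdf_expR a s x : s != 0 ->
  normal_pdf a s x = normal_peak s * expR (- (x - a) ^+ 2 / (s ^+ 2 *+ 2)).
Proof. by move=> s0; rewrite normal_pdfE. Qed.

Lemma normal_pdf_gt0 a s x : s != 0 -> 0 < normal_pdf a s x.
Proof. by move=> s0; rewrite normal_pdf_expR// mulr_gt0 ?normal_peak_gt0 ?expR_gt0. Qed.

Lemma normal_pdfN s x : s != 0 -> normal_pdf 0 s (- x) = normal_pdf 0 s x.
Proof. by move=> s0; rewrite !normal_pdf_expR// !subr0 sqrrN. Qed.

Lemma normal_peak_scale s : 0 < s -> s * normal_peak s = normal_peak 1.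
Proof.
move=> s0; rewrite /normal_peak expr1n mul1r -mulrnAr sqrtrM ?sqr_ge0//.
by rewrite sqrtr_sqr gtr0_norm// invfM mulrA divff ?gt_eqF// mul1r.
Qed.

Lemma normal_pdf_scale a s x : 0 < s ->
  s * normal_pdf a s (s * x + a) = normal_pdf 0 1 x.
Proof.
move=> s0; have sN0 : s != 0 by rewrite gt_eqF.
rewrite !normal_pdf_expR// mulrA normal_peak_scale//; congr (_ * expR _).
by rewrite addrK; field.
Qed.

Lemma ge0_integral_normal_std a s (f : R -> \bar R) : 0 < s ->
  measurable_fun setT f -> (forall x, 0 <= f x)%E ->
  (\int[mu]_u (f u * (normal_pdf a s u)%:E) =
   \int[mu]_v (f (s * v + a)%R * (normal_pdf 0 1 v)%:E))%E.
Proof.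
move=> s0 mf f0.
have mn : measurable_fun [set: R] (EFin \o normal_pdf a s).
  by apply/measurable_EFinP; exact: measurable_normal_pdf.
have mfn : measurable_fun [set: R] (fun u : R => f u * (normal_pdf a s u)%:E)%E.
  exact: (emeasurable_funM mf mn).
have fn0 x : (0 <= f x * (normal_pdf a s x)%:E)%E.
  by rewrite mule_ge0// lee_fin normal_pdf_ge0.
rewrite (ge0_integral_affine_gt0 a s0 mfn fn0) -ge0_integralZl//; last 2 first.
- exact: (measurableT_comp mfn (measurable_affine s a)).
- by rewrite lee_fin ltW.
apply: eq_integral => x _.
by rewrite muleCA -EFinM normal_pdf_scale.
Qed.

Lemma std_PhiE x :
  (std_Phi x)%:E = (\int[mu]_(u in `]-oo, x]) (normal_pdf 0 1 u)%:E)%E.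
Proof.
rewrite /std_Phi fineK//; apply: integrable_fin_num => //.
by apply: (integrableS measurableT) => //; exact: integrable_normal_pdf.
Qed.

Lemma std_Phi_ge0 x : 0 <= std_Phi x.
Proof.
by rewrite -lee_fin std_PhiE; apply: integral_ge0 => u _; rewrite lee_fin normal_pdf_ge0.
Qed.

Lemma std_Phi_le1 x : std_Phi x <= 1.
Proof.
rewrite -lee_fin std_PhiE -(integral_normal_pdf 0 1).
apply: ge0_subset_integral => //.
- by apply/measurable_EFinP; exact: measurable_normal_pdf.
- by move=> u _; rewrite lee_fin normal_pdf_ge0.
Qed.

Lemma std_Phi_nd : {homo @std_Phi R : x y / x <= y}.
Proof.
move=> x y xy; rewrite -lee_fin !std_PhiE; apply: ge0_subset_integral => //.
- apply: measurable_funTS; apply/measurable_EFinP; exact: measurable_normal_pdf.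
- by move=> u _; rewrite lee_fin normal_pdf_ge0.
- by apply: subset_itvl; rewrite bnd_simp.
Qed.

Lemma measurable_std_Phi : measurable_fun setT (@std_Phi R).
Proof. by apply: nondecreasing_measurable => //; exact: std_Phi_nd. Qed.

Lemma std_Phi_gt0 x : 0 < std_Phi x.
Proof.
rewrite -lte_fin std_PhiE.
(* On [[x - 1, x]] one has [|u| <= |x| + 1], so [c] bounds the density from below on an interval of
   length 1. *)
pose c := normal_pdf 0 1 (`|x| + 1).
have c0 : 0 < c by exact: normal_pdf_gt0.
apply: (@lt_le_trans _ _ (\int[mu]_(u in `[(x - 1)%R, x]) (c)%:E)%E).
  rewrite integral_cst//= lebesgue_measure_itv/= lte_fin.
  by rewrite ltrBlDr ltrDl ltr01 -EFinB -EFinM lte_fin mulr_gt0//; lra.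
apply: (@le_trans _ _ (\int[mu]_(u in `[(x - 1)%R, x]) (normal_pdf 0 1 u)%:E)%E).
  apply: ge0_le_integral => //.
  - by move=> u _; rewrite lee_fin ltW.
  - by apply: measurable_funTS; apply/measurable_EFinP; exact: measurable_normal_pdf.
  - move=> u; rewrite /= in_itv/= => /andP[ux xu].
    rewrite lee_fin /c !normal_pdf_expR// ler_pM2l ?normal_peak_gt0// ler_expR.
    rewrite !subr0 ler_pM2r ?invr_gt0//.
    rewrite lerN2 -(real_normK (num_real u)) ler_sqr ?nnegrE ?addr_ge0//.
    by rewrite ler_norml; have := ler_norm x; have := ler_norm (- x); rewrite normrN; lra.
apply: ge0_subset_integral => //.
- by apply: measurable_funTS; apply/measurable_EFinP; exact: measurable_normal_pdf.
- by move=> u _; rewrite lee_fin normal_pdf_ge0.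
- by apply: subset_itvr; rewrite bnd_simp.
Qed.

(** Standardising turns the half-line into [v > - a / s], and the reflection [v |-> - v] into
    [v < a / s]. This is the normalising constant of [tn_pdf]. *)
Lemma integral_normal_gt0 a s : 0 < s ->
  (\int[mu]_(u in `]0%R, +oo[) (normal_pdf a s u)%:E = (std_Phi (a / s))%:E)%E.
Proof.
move=> s0; rewrite integral_indicM ge0_integral_normal_std//; last first.
  exact: measurable_EFin_indic.
rewrite ge0_integral_opp//; last 2 first.
- apply: (@emeasurable_funM _ R); last exact: measurable_EFin_normal_pdf.
  have m0 : measurable (`]0%R, +oo[ : set R) by [].
  exact: (measurableT_comp (measurable_EFin_indic m0) (measurable_affine s a)).
- by move=> x; rewrite mule_ge0 ?lee_fin ?normal_pdf_ge0.
rewrite std_PhiE -integral_itv_bndo_bndc; last first.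
  by apply: measurable_funTS; apply/measurable_EFinP; exact: measurable_normal_pdf.
rewrite [RHS]integral_indicM; apply: eq_integral => x _.
rewrite normal_pdfN ?oner_neq0//; congr (_%:E * _)%E.
rewrite !indicE !mem_setE !in_itv/= andbT.
by rewrite ltr_pdivlMr// mulrN addrC subr_gt0 mulrC.
Qed.

(** Doubling the standard deviation absorbs any power of [u]. The bound serves both to integrate all
    moments and to kill boundary terms at infinity. *)
Lemma normr_exp_normal_le a s k : 0 < s -> exists2 C, 0 <= C &
  forall u : R, `|u| ^+ k * normal_pdf a s u <= C * normal_pdf a (2 * s) u.
Proof.
move=> s0; have sN0 : s != 0 by rewrite gt_eqF.
have s2N0 : 2 * s != 0 by rewrite mulf_neq0.
(* With [y = (u - a)^2 / b], the power contributes [exp (k y)], and [b] is chosen so that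
   [k y <= (u - a)^2 / (4 s^2)]. The remaining exponent is [- (u - a)^2 / (4 s^2)], below the
   required [- (u - a)^2 / (8 s^2)]. The constant [C0] comes from [|u| <= |a| + 1 + (u - a)^2 = |a|
   + 1 + b y <= C0 (1 + y)]. *)
pose b : R := 4 * s ^+ 2 * k.+1%:R.
have b0 : 0 < b by rewrite !mulr_gt0// exprn_gt0.
pose C0 := `|a| + 1 + b.
have C00 : 0 <= C0 by rewrite !addr_ge0// ltW.
exists (C0 ^+ k * normal_peak s / normal_peak (2 * s)).
  by rewrite !mulr_ge0 ?exprn_ge0 ?invr_ge0 ?normal_peak_ge0.
move=> u; rewrite !normal_pdf_expR//.
rewrite [leRHS]mulrA divfK ?gt_eqF ?normal_peak_gt0//.
rewrite [leLHS]mulrCA -mulrA [leRHS]mulrCA ler_pM2l ?normal_peak_gt0//.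
pose y := (u - a) ^+ 2 / b.
have y0 : 0 <= y by rewrite divr_ge0 ?sqr_ge0 ?ltW.
have u1 : `|u| <= C0 * expR y.
  apply: (@le_trans _ _ (C0 * (1 + y))); last first.
    by rewrite ler_wpM2l// expR_ge1Dx.
  have : `|u| <= `|a| + `|u - a|.
    by rewrite -{1}(subrK a u) addrC ler_normD.
  have ua : `|u - a| <= 1 + (u - a) ^+ 2.
    rewrite -(real_normK (num_real _)); move: `|u - a| => z.
    by have := sqr_ge0 (z - 1/2); rewrite !expr2; nra.
  have : (u - a) ^+ 2 = y * b by rewrite divfK ?gt_eqF.
  have := normr_ge0 a; rewrite /C0; move: ua; move: `|u - a| `|u| `|a| ((u - a)^+2) => p q r t.
  by nra.
apply: (@le_trans _ _ ((C0 * expR y) ^+ k * expR (- (u - a) ^+ 2 / (s ^+ 2 *+ 2)))).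
  by rewrite ler_wpM2r ?expR_ge0// lerXn2r// nnegrE mulr_ge0// expR_ge0.
rewrite exprMn -mulrA ler_wpM2l ?exprn_ge0// -expRM_natl -expRD ler_expR.
have -> : k%:R * y = (u - a) ^+ 2 / s ^+ 2 * (k%:R / (4 * k.+1%:R)).
  have : (k.+1%:R : R) != 0 by rewrite pnatr_eq0.
  by rewrite /y /b; move: (k.+1%:R : R) => K K0; field; rewrite sN0 K0.
have kk : (k%:R / (4 * k.+1%:R) : R) <= 1 / 4.
  rewrite ler_pdivrMr ?mulr_gt0// mulrA divfK// mul1r ler_nat//.
have -> : - (u - a) ^+ 2 / (s ^+ 2 *+ 2) = - ((u - a) ^+ 2 / s ^+ 2) * (1 / 2).
  by field.
have -> : - (u - a) ^+ 2 / ((2 * s) ^+ 2 *+ 2) = - ((u - a) ^+ 2 / s ^+ 2) * (1 / 8).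
  by field.
have : 0 <= (u - a) ^+ 2 / s ^+ 2 by rewrite divr_ge0 ?sqr_ge0.
by move: kk; move: ((u - a) ^+ 2 / s ^+ 2) (k%:R / (4 * k.+1%:R)) => p q; nra.
Qed.

Lemma integrable_exp_normal a s k : 0 < s ->
  mu.-integrable setT (fun u : R => (u ^+ k * normal_pdf a s u)%:E).
Proof.
move=> s0; have [C C0 hC] := normr_exp_normal_le a k s0.
have iC := integrableZl measurableT C (integrable_normal_pdf a (2 * s)).
apply: le_integrable iC => //.
- apply/measurable_EFinP; apply: measurable_funM; first exact: measurable_funX.
  exact: measurable_normal_pdf.
- move=> u _; rewrite -EFinM !abse_EFin lee_fin [leRHS]ger0_norm; last first.
    by rewrite mulr_ge0// normal_pdf_ge0.
  apply: le_trans (hC u).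
  by rewrite normrM normrX (ger0_norm (normal_pdf_ge0 _ _ _)).
Qed.

Lemma cvg_normal_pdfy a s : 0 < s -> normal_pdf a s n%:R @[n --> \oo] --> 0.
Proof.
move=> s0; have sN0 : s != 0 by rewrite gt_eqF.
rewrite (_ : (fun n => _) = (fun n => normal_peak s *
   gauss_fun ((n%:R - a) / (Num.sqrt (s ^+ 2 *+ 2))))); last first.
  apply/funext => n; rewrite normal_pdf_expR//; congr (_ * expR _).
  by rewrite expr_div_n sqr_sqrtr ?mulNr// mulrn_wge0// sqr_ge0.
rewrite -[X in _ --> X](mulr0 (normal_peak s)); apply: cvgMr.
apply: (cvg_comp (fun n : nat => (n%:R - a) / (Num.sqrt (s ^+ 2 *+ 2)))
   gauss_fun) cvg_gauss_fun.
apply: (cvg_comp (fun n : nat => n%:R) (fun r : R => (r - a) / (Num.sqrt (s ^+ 2 *+ 2)))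
  cvgr_idn).
apply: gt0_cvgMly; last exact: cvg_addrr.
by rewrite invr_gt0 sqrtr_gt0 mulrn_wgt0// exprn_gt0.
Qed.

Lemma cvg_exp_normaly a s k : 0 < s ->
  n%:R ^+ k * normal_pdf a s n%:R @[n --> \oo] --> 0.
Proof.
move=> s0; have [C C0 hC] := normr_exp_normal_le a k s0.
apply: (@squeeze_cvgr _ _ _ _ (fun=> 0) (fun n : nat => C * normal_pdf a (2 * s) n%:R)).
- apply: nearW => n; rewrite mulr_ge0 ?exprn_ge0 ?normal_pdf_ge0//=.
  by have := hC n%:R; rewrite normr_nat.
- exact: cvg_cst.
- rewrite -[X in _ --> X](mulr0 C); apply: cvgMr; apply: cvg_normal_pdfy.
  by rewrite mulr_gt0.
Qed.

Lemma is_derive_normal_pdf a s x : s != 0 ->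
  is_derive x 1 (normal_pdf a s) (- (x - a) / s ^+ 2 * normal_pdf a s x).
Proof.
move=> s0.
rewrite (_ : normal_pdf a s = fun x => normal_peak s * expR (- (x - a) ^+ 2 / (s ^+ 2 *+ 2)));
  last by apply/funext => u; rewrite normal_pdf_expR.
apply: is_derive_eq; rewrite /GRing.scale/=; field.
by rewrite s0.
Qed.

End gaussian.

(** * The fundamental theorem of calculus on unbounded intervals *)

Section improper_integrals.
Context {R : realType}.
Notation mu := (@lebesgue_measure R).

Lemma cvg_integral_itvNn (D : set R) (f : R -> R) : measurable D ->
  mu.-integrable D (EFin \o f) ->
  (\int[mu]_(x in D `&` `[(- n%:R)%R, n%:R%R]) (f x)%:E)%E @[n --> \oo] -->
  (\int[mu]_(x in D) (f x)%:E)%E.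
Proof.
move=> mD intf.
have mf : measurable_fun D (EFin \o f) := measurable_int _ intf.
under eq_fun do rewrite integral_mkcondr.
apply: (@dominated_cvg _ _ _ mu D mD _ _ (abse \o (EFin \o f))) => //.
- move=> n; apply/measurable_restrict => //; apply: measurable_funS mf => //.
- move=> x Dx; apply: cvg_near_cst; near=> n.
  rewrite patchE ifT// inE/= in_itv/= -ler_norml.
  near: n; exact: nbhs_infty_ger.
- exact: integrable_abse.
- move=> n x Dx; rewrite patchE; case: ifPn => // _.
  by rewrite abse0 abse_ge0.
Unshelve. all: by end_near. Qed.

Lemma integral_itv_derive (f F : R -> R) (a b : R) : a <= b ->
  continuous f -> (forall x : R, is_derive x 1 F (f x)) ->
  (\int[mu]_(x in `[a, b]) (f x)%:E = (F b - F a)%:E)%E.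
Proof.
move=> ab cf dF; have cF x : {for x, continuous F}.
  apply: differentiable_continuous; apply/derivable1_diffP.
  by have := dF x.
move: ab; rewrite le_eqVlt => /predU1P[<-|ab].
  by rewrite set_itv1 integral_set1 subrr.
rewrite (continuous_FTC2 ab (F := F)) ?EFinB//.
- exact: continuous_subspaceT.
- split.
  + by move=> x _; have := dF x.
  + by apply: cvg_at_right_filter; exact: cF.
  + by apply: cvg_at_left_filter; exact: cF.
- by move=> x _; rewrite derive1E derive_val.
Qed.

Lemma integral_itvcy_derive (f F : R -> R) (l : R) :
  continuous f -> mu.-integrable `[0, +oo[ (EFin \o f) ->
  (forall x : R, is_derive x 1 F (f x)) -> F n%:R @[n --> \oo] --> l ->
  (\int[mu]_(x in `[0%R, +oo[) (f x)%:E = (l - F 0)%:E)%E.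
Proof.
move=> cf intf dF Fl.
have := @cvg_integral_itvNn `[0%R, +oo[ f (measurable_itv _) intf.
rewrite (_ : (fun n => _) = (fun n : nat => (F n%:R - F 0)%:E)); last first.
  apply/funext => n; rewrite -integral_itv_derive//.
  congr (integral _ _ _); apply/seteqP; split => x /=; rewrite !in_itv/= ?andbT.
    by move=> [-> /andP[_ ->]].
  move=> /andP[x0 ->]; rewrite x0; split => //; rewrite andbT.
  by rewrite (le_trans _ x0)// oppr_le0.
move=> h; apply: (cvg_unique _ h) => //.
apply: cvg_EFin; first by apply: nearW.
by apply: cvgB => //; exact: cvg_cst.
Qed.

Lemma integral_derive0 (f F : R -> R) :
  continuous f -> mu.-integrable setT (EFin \o f) ->
  (forall x : R, is_derive x 1 F (f x)) ->
  F n%:R @[n --> \oo] --> 0 -> F (- n%:R) @[n --> \oo] --> 0 ->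
  \int[mu]_x f x = 0.
Proof.
move=> cf intf dF F0 F0'.
have := @cvg_integral_itvNn setT f measurableT intf.
rewrite (_ : (fun n => _) = (fun n : nat => (F n%:R - F (- n%:R))%:E)); last first.
  apply/funext => n; rewrite -integral_itv_derive// ?setTI//.
  by rewrite (@le_trans _ _ 0)// oppr_le0.
move=> h; rewrite /Rintegral (_ : integral _ _ _ = 0%E)//.
apply: (cvg_unique _ h) => //.
apply: cvg_EFin; first by apply: nearW.
by rewrite -[X in _ --> X](subrr 0); apply: cvgB.
Qed.

End improper_integrals.

(** * The Fourier transform of a centred Gaussian, with a phase *)

Section gaussian_charfun.
Context {R : realType}.
Notation mu := (@lebesgue_measure R).
Variables (s th : R).
Hypothesis s0 : 0 < s.
Local Notation q := (normal_pdf 0 s).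

Let sN0 : s != 0. Proof. by rewrite gt_eqF. Qed.

Let mcos t : measurable_fun [set: R] (fun x : R => cos (t * x + th)).
Proof.
apply: continuous_measurable_fun => x; apply: continuous_comp.
  by apply: cvgD; [apply: cvgM; [exact: cvg_cst|exact: cvg_id]|exact: cvg_cst].
exact: continuous_cos.
Qed.

Let msin t : measurable_fun [set: R] (fun x : R => sin (t * x + th)).
Proof.
apply: continuous_measurable_fun => x; apply: continuous_comp.
  by apply: cvgD; [apply: cvgM; [exact: cvg_cst|exact: cvg_id]|exact: cvg_cst].
exact: continuous_sin.
Qed.

Let mq : measurable_fun [set: R] q. Proof. exact: measurable_normal_pdf. Qed.

Let mcosq t : measurable_fun [set: R] (fun x : R => cos (t * x + th) * q x).
Proof. exact: measurable_funM. Qed.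

Let msinq t : measurable_fun [set: R] (fun x : R => - x * sin (t * x + th) * q x).
Proof.
by apply: measurable_funM => //; apply: measurable_funM => //; exact: measurable_oppr.
Qed.

Let mabsq : measurable_fun [set: R] (fun x : R => `|x| * q x).
Proof. by apply: measurable_funM => //; exact: measurable_normr. Qed.

Lemma cos_norm_le1 (x : R) : `|cos x| <= 1.
Proof. by rewrite ler_norml cos_geN1 cos_le1. Qed.

Lemma sin_norm_le1 (x : R) : `|sin x| <= 1.
Proof. by rewrite ler_norml sin_geN1 sin_le1. Qed.

Let icos t : mu.-integrable setT (fun x : R => (cos (t * x + th) * q x)%:E).
Proof.
apply: le_integrable (integrable_normal_pdf 0 s) => //.
- exact: measurable_EFin_comp (mcosq t).
- move=> x _; rewrite !abse_EFin lee_fin normrM.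
  by rewrite ler_piMl// cos_norm_le1.
Qed.

Let isin t : mu.-integrable setT (fun x : R => (- x * sin (t * x + th) * q x)%:E).
Proof.
apply: le_integrable (integrable_exp_normal 0 1 s0) => //.
- exact: measurable_EFin_comp (msinq t).
- move=> x _; rewrite !abse_EFin lee_fin expr1 !normrM normrN.
  by rewrite ler_wpM2r// ler_piMr// sin_norm_le1.
Qed.

Let psi t := \int[mu]_x (cos (t * x + th) * q x).

(** The derivative of the integrand in [t] is dominated by [|x| * q x] whatever the value of [t],
    which licenses differentiation under the integral sign. *)
Let dpsi (t : R) : is_derive t 1 psi (\int[mu]_x (- x * sin (t * x + th) * q x)).
Proof.
pose f := fun t x : R => cos (t * x + th) * q x.
have dE (u x : R) : is_derive u 1 (f^~ x) (- x * sin (u * x + th) * q x).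
  by apply: is_derive_eq; rewrite /GRing.scale/=; ring.
have pE u x : partial1of2 f u x = - x * sin (u * x + th) * q x.
  by rewrite partial1of2E; exact: derive_val.
have iG : mu.-integrable setT (EFin \o (fun x : R => `|x| * q x)).
  apply: le_integrable (integrable_exp_normal 0 1 s0) => //.
    exact: measurable_EFin_comp mabsq.
  by move=> x _; rewrite !abse_EFin lee_fin expr1 !normrM normr_id.
have G0 (x : R) : 0 <= `|x| * q x by rewrite mulr_ge0// normal_pdf_ge0.
have tI : `]t - 1, t + 1[%classic t by rewrite /= in_itv/=; apply/andP; split; lra.
have hub u (x : R) : `]t - 1, t + 1[%classic u -> [set: R] x ->
    `|partial1of2 f u x| <= `|x| * q x.
  move=> _ _; rewrite pE !normrM normrN (ger0_norm (normal_pdf_ge0 _ _ _)).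
  by rewrite ler_wpM2r ?normal_pdf_ge0// ler_piMr// sin_norm_le1.
have D := @derivable_under_integral R _ _ mu f setT measurableT t (t - 1) (t + 1) tI
  (fun u _ => icos u) (fun u x _ _ => @ex_derive _ _ _ _ _ _ _ (dE u x)) _ G0 iG hub.
have E := @differentiation_under_integral R _ _ mu f setT measurableT t (t - 1) (t + 1) tI
  (fun u _ => icos u) (fun u x _ _ => @ex_derive _ _ _ _ _ _ _ (dE u x)) _ G0 iG hub.
apply: DeriveDef; first exact: D.
by rewrite -derive1E E; apply: eq_Rintegral => x _; rewrite pE.
Qed.

(** Integration by parts: since [q' = - x q / s^2], the difference of the two integrands is the
    derivative of [s^2 sin (t x + th) q x], which vanishes at both ends. *)
Let stein t : \int[mu]_x (- x * sin (t * x + th) * q x) = - (s ^+ 2 * t) * psi t.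
Proof.
pose F (x : R) := s ^+ 2 * (sin (t * x + th) * q x).
have dF (x : R) : is_derive x 1 F (- x * sin (t * x + th) * q x +
    s ^+ 2 * t * (cos (t * x + th) * q x)).
  have dq := is_derive_normal_pdf 0 x sN0.
  apply: is_derive_eq; rewrite /GRing.scale/= subr0; field.
  by rewrite sN0.
have i2 := integrableZl measurableT (s ^+ 2 * t) (icos t).
have : \int[mu]_x (- x * sin (t * x + th) * q x +
    s ^+ 2 * t * (cos (t * x + th) * q x)) = 0.
  have Fq (x : R) : `|F x| <= s ^+ 2 * q x.
    rewrite /F normrM (ger0_norm (sqr_ge0 s)) normrM (ger0_norm (normal_pdf_ge0 _ _ _)).
    by rewrite ler_wpM2l ?sqr_ge0// ler_piMl ?normal_pdf_ge0// sin_norm_le1.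
  have sq0 : s ^+ 2 * q n%:R @[n --> \oo] --> 0.
    by rewrite -[X in _ --> X](mulr0 (s ^+ 2)); apply: cvgMr; exact: cvg_normal_pdfy.
  apply: (integral_derive0 _ _ dF).
  - move=> x; have cq : q x @[x --> x] --> q x by exact: continuous_normal_pdf.
    have ct : t * x + th @[x --> x] --> t * x + th.
      by apply: cvgD; [apply: cvgM; [exact: cvg_cst|exact: cvg_id]|exact: cvg_cst].
    apply: cvgD.
      apply: cvgM => //; apply: cvgM; first by apply: cvgN; exact: cvg_id.
      by apply: (cvg_comp _ _ ct); exact: continuous_sin.
    apply: cvgM; first exact: cvg_cst.
    by apply: cvgM => //; apply: (cvg_comp _ _ ct); exact: continuous_cos.
  - rewrite (_ : EFin \o _ = (fun x : R => (- x * sin (t * x + th) * q x)%:E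
      + (s ^+ 2 * t)%:E * (cos (t * x + th) * q x)%:E)%E)//.
    exact: integrableD.
  - apply/norm_cvg0P; apply: (squeeze_cvgr _ (cvg_cst 0) sq0).
    by apply: nearW => n; rewrite normr_ge0/=.
  - apply/norm_cvg0P; apply: (squeeze_cvgr _ (cvg_cst 0) sq0).
    by apply: nearW => n; rewrite normr_ge0/= -normal_pdfN.
rewrite (RintegralD measurableT (isin t) i2).
rewrite [X in _ + X = _ -> _](RintegralZl _ measurableT (icos t)) => /eqP; rewrite addr_eq0 => /eqP ->.
by rewrite mulNr.
Qed.

(** By [dpsi] and [stein], [psi] solves [psi' = - s^2 t psi]. Multiplying by [exp (s^2 t^2 / 2)]
    gives a function with zero derivative, whose value at 0 is [cos th]. *)
Lemma gaussian_charfun t :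
  \int[mu]_x (cos (t * x + th) * q x) = cos th * expR (- (s * t) ^+ 2 / 2).
Proof.
pose G u := psi u * expR ((s * u) ^+ 2 / 2).
have dG (u : R) : is_derive u 1 G 0.
  have d1 := dpsi u; rewrite stein in d1.
  by apply: is_derive_eq; rewrite /GRing.scale/=; field.
have := is_derive_0_is_cst t 0 dG.
rewrite /G mulr0 expr0n/= mul0r expR0 mulr1.
have -> : psi 0 = cos th.
  rewrite /psi; under eq_Rintegral do rewrite mul0r add0r.
  rewrite RintegralZl//; last exact: integrable_normal_pdf.
  by rewrite /Rintegral integral_normal_pdf mulr1.
move=> <-; rewrite -mulrA -expRD mulNr addrN expR0 mulr1.
by [].
Qed.

End gaussian_charfun.

(** * Bounded measurable functions and their expectations *)

Section bounded_measurable.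
Context d (T : measurableType d) (R : realType).
Notation mu := (@lebesgue_measure R).
Implicit Types (f g H X : T -> R).

(** This class consists of integrable functions under a probability and, unlike integrable functions
    at large, is closed under products. *)
Definition bounded_measurable f :=
  measurable_fun setT f /\ exists M, forall t, `|f t| <= M.
Local Notation bm := bounded_measurable.

Lemma bounded_measurable_ge0 f : bm f ->
  measurable_fun setT f /\ exists2 M, 0 <= M & forall t, `|f t| <= M.
Proof.
move=> [mf [M fM]]; split=> //; exists `|M| => // t.
by rewrite (le_trans (fM t))// ler_norm.
Qed.

Lemma bm_cst (c : R) : bm (fun=> c).
Proof. by split; [exact: measurable_cst|exists `|c|]. Qed.

Lemma bmM f g : bm f -> bm g -> bm (fun t => f t * g t).
Proof.
move=> /bounded_measurable_ge0[mf [M M0 fM]] /bounded_measurable_ge0[mg [N N0 gN]].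
split; first exact: measurable_funM.
by exists (M * N) => t; rewrite normrM ler_pM.
Qed.

Lemma bmZ c f : bm f -> bm (fun t => c * f t).
Proof. by move=> bf; apply: bmM => //; exact: bm_cst. Qed.

Lemma bmD f g : bm f -> bm g -> bm (fun t => f t + g t).
Proof.
move=> [mf [M fM]] [mg [N gN]]; split; first exact: measurable_funD.
by exists (M + N) => t; rewrite (le_trans (ler_normD _ _))// lerD.
Qed.

Lemma bmB f g : bm f -> bm g -> bm (fun t => f t - g t).
Proof.
move=> [mf [M fM]] [mg [N gN]]; split; first exact: measurable_funB.
by exists (M + N) => t; rewrite (le_trans (ler_normB _ _))// lerD.
Qed.

Lemma bm_cos X : measurable_fun setT X -> bm (fun t => cos (X t)).
Proof.
move=> mX; split; last by exists 1 => t; exact: cos_norm_le1.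
by apply: measurableT_comp => //; apply: continuous_measurable_fun; exact: continuous_cos.
Qed.

Lemma bm_sin X : measurable_fun setT X -> bm (fun t => sin (X t)).
Proof.
move=> mX; split; last by exists 1 => t; exact: sin_norm_le1.
by apply: measurableT_comp => //; apply: continuous_measurable_fun; exact: continuous_sin.
Qed.

Lemma indic_norm_le1 (U : Type) (C : set U) x : `|\1_C x : R| <= 1.
Proof. by rewrite indicE; case: (_ \in _); rewrite ?normr1 ?normr0. Qed.

Lemma bm_indic X (C : set R) : measurable_fun setT X -> measurable C ->
  bm (fun t => \1_C (X t)).
Proof.
move=> mX mC; split; last by exists 1 => t; exact: indic_norm_le1.
by apply: measurableT_comp => //; exact: measurable_indic.
Qed.

Section expectation.
Variable P : probability T R.
Local Notation Ex := (Rintegral P setT).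

Lemma bm_integrable f : bm f -> P.-integrable setT (EFin \o f).
Proof.
move=> /bounded_measurable_ge0[mf [M M0 fM]].
apply: (@le_integrable _ _ _ _ _ _ _ (cst M%:E)) => //.
- exact/measurable_EFinP.
- by move=> t _; rewrite !abse_EFin lee_fin (ger0_norm M0).
- exact: finite_measure_integrable_cst.
Qed.

Lemma EFin_bmRintegral f : bm f -> (Ex f)%:E = (\int[P]_t (f t)%:E)%E.
Proof.
by move=> bf; rewrite /Rintegral fineK//; apply: integrable_fin_num => //; exact: bm_integrable.
Qed.

Lemma Rintegral_prob_cst (c : R) : Ex (fun=> c) = c.
Proof. by rewrite Rintegral_cst//= probability_setT mulr1. Qed.

Lemma bmRintegralD f g : bm f -> bm g -> Ex (fun t => f t + g t) = Ex f + Ex g.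
Proof. by move=> bf bg; rewrite RintegralD//; exact: bm_integrable. Qed.

Lemma bmRintegralB f g : bm f -> bm g -> Ex (fun t => f t - g t) = Ex f - Ex g.
Proof. by move=> bf bg; rewrite RintegralB//; exact: bm_integrable. Qed.

Lemma bmRintegralZ c f : bm f -> Ex (fun t => c * f t) = c * Ex f.
Proof. by move=> bf; rewrite RintegralZl//; exact: bm_integrable. Qed.

(** The signed version follows from the nonnegative one applied to [f + M]; the constant is
    subtracted again because [q] has total mass 1. *)
Lemma Rintegral_density X (q f : R -> R) (M : R) : measurable_fun setT X ->
  measurable_fun setT q -> (forall x, 0 <= q x) ->
  (forall A : set R, measurable A -> P (X @^-1` A) = (\int[mu]_(x in A) (q x)%:E)%E) ->
  measurable_fun setT f -> (forall x, `|f x| <= M) ->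
  Ex (fun t => f (X t)) = \int[mu]_x (f x * q x).
Proof.
move=> mX mq q0 lawX mf fM.
have q1 : (\int[mu]_x (q x)%:E = 1)%E.
  by rewrite -lawX// preimage_setT probability_setT.
have iq : mu.-integrable setT (EFin \o q).
  apply/integrableP; split; first exact: measurable_EFin_comp mq.
  under eq_integral do rewrite /= ger0_norm//.
  by rewrite q1 ltry.
have mfq : measurable_fun [set: R] (fun x : R => f x * q x) by exact: measurable_funM.
have ifq : mu.-integrable setT (EFin \o (fun x => f x * q x)).
  have := integrableZl measurableT `|M| iq; apply: le_integrable => //.
    exact: measurable_EFin_comp mfq.
  move=> x _; rewrite -EFinM !abse_EFin lee_fin !normrM ler_wpM2r// normr_id.
  by rewrite (le_trans (fM x))// ler_norm.
have bfX : bm (fun t => f (X t)).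
  by split; [exact: measurableT_comp|exists M => t].
have mfM : measurable_fun [set: R] (fun x => (f x + M)%:E).
  by apply/measurable_EFinP; exact: measurable_funD.
have fM0 x : (0 <= (f x + M)%:E)%E.
  rewrite lee_fin -lerBlDr sub0r.
  by have := fM x; rewrite ler_norml => /andP[].
have E1 : Ex (fun t => f (X t) + M) = \int[mu]_x (f x * q x + M * q x).
  rewrite /Rintegral (ge0_integral_density mX mq q0 lawX mfM fM0).
  by congr fine; apply: eq_integral => x _; rewrite -EFinM mulrDl.
move: E1; rewrite bmRintegralD//; last exact: bm_cst.
rewrite Rintegral_prob_cst RintegralD//; last by have := integrableZl measurableT M iq.
by rewrite (@RintegralZl _ _ _ mu setT q)// [X in _ + _ * X]/Rintegral q1 mulr1 => /addIr.
Qed.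

(** Dominated convergence with a constant as dominating function: orthogonality survives bounded
    pointwise limits of test functions. *)
Lemma Rintegral_cvg0 (M : R) (h_ : nat -> T -> R) (h : T -> R) :
  (forall n, measurable_fun setT (h_ n)) -> (forall n t, `|h_ n t| <= M) ->
  (forall t, h_ n t @[n --> \oo] --> h t) ->
  (forall n, Ex (h_ n) = 0) -> Ex h = 0.
Proof.
move=> mh hM hcvg Eh.
have bh n : bm (h_ n) by split=> //; exists M.
have : (\int[P]_t (h_ n t)%:E)%E @[n --> \oo] --> (\int[P]_t (h t)%:E)%E.
  apply: (@dominated_cvg _ _ _ P setT measurableT _ _ (cst M%:E)) => //.
  - by move=> n; exact/measurable_EFinP.
  - by move=> t _; apply: cvg_EFin; [exact: nearW|exact: hcvg].
  - exact: finite_measure_integrable_cst.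
  - by move=> n t _; rewrite abse_EFin lee_fin.
rewrite (_ : (fun n => _) = cst 0%E); last first.
  by apply/funext => n; rewrite -EFin_bmRintegral// Eh.
move=> h0; rewrite /Rintegral (_ : integral _ _ _ = 0%E)//.
by apply: (cvg_unique _ h0) => //; exact: cvg_cst.
Qed.

(** Orthogonality survives mixtures of test functions over a parameter [s]. A bound on the
    [s]-integral that is uniform in [t] suffices for Fubini, as [P] has mass 1. *)
Lemma Rintegral_fubini0 (C : R) (h : T * measurableTypeR R -> R) :
  measurable_fun setT h ->
  (forall t, \int[mu]_s `|h (t, s)|%:E <= C%:E)%E ->
  (forall s, bm (fun t => h (t, s))) ->
  (forall s, Ex (fun t => h (t, s)) = 0) ->
  Ex (fun t => \int[mu]_s h (t, s)) = 0.
Proof.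
move=> mh hC bh Eh.
have mf : measurable_fun setT (EFin \o h) by exact/measurable_EFinP.
have mht t : measurable_fun setT (fun s => (h (t, s))%:E).
  exact: (measurableT_comp mf (pair1_measurable t)).
have fh t : (\int[mu]_s (h (t, s))%:E)%E \is a fin_num.
  rewrite fin_num_abs; apply: le_lt_trans (ltry C).
  apply: (le_trans (le_abse_integral mu measurableT (mht t))); exact: hC.
have ih : (P \x mu)%E.-integrable setT (EFin \o h).
  apply/integrable12ltyP => //.
  apply: le_lt_trans (ltry C).
  rewrite -[leRHS](_ : \int[P]_t C%:E = _)%E; last first.
    by rewrite integral_cst//= probability_setT mule1.
  apply: ge0_le_integral => //.
  - by move=> t _; exact: integral_ge0.
  - apply: (@measurable_fun_fubini_tonelli_F _ _ _ _ _ mu (abse \o (EFin \o h))).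
      exact: measurableT_comp.
    by move=> z; exact: abse_ge0.
  - by move=> t _; exact: hC.
have := Fubini ih.
rewrite [RHS](_ : _ = 0%E); last first.
  apply: integral0_eq => s _ /=.
  by rewrite -(EFin_bmRintegral (bh s)) Eh.
rewrite /Rintegral => h0.
under eq_integral do rewrite fineK//.
by rewrite h0.
Qed.

End expectation.
End bounded_measurable.

(** * Limits of the normal distribution function *)

Section normal_cdf_limits.
Context {R : realType}.
Notation mu := (@lebesgue_measure R).

Lemma integral_normal_le (a s b : R) : 0 < s ->
  \int[mu]_v (\1_(`]-oo, b]) v * normal_pdf a s v) = std_Phi ((b - a) / s).
Proof.
move=> s0; rewrite /Rintegral.
under eq_integral do rewrite EFinM.
rewrite ge0_integral_normal_std//; last first.
  exact: measurable_EFin_indic.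
apply: EFin_inj; rewrite std_PhiE [in RHS]integral_indicM fineK; last first.
  rewrite (_ : (fun v => _) = fun v : R => ((\1_(`]-oo, (b - a) / s]) v)%:E * (normal_pdf 0 1 v)%:E)%E).
    by rewrite -integral_indicM -std_PhiE.
  apply/funext => v; congr (_%:E * _)%E; rewrite !indicE !mem_setE !in_itv/=.
  by rewrite ler_pdivlMr// lerBrDr mulrC.
apply: eq_integral => v _; congr (_%:E * _)%E; rewrite !indicE !mem_setE !in_itv/=.
by rewrite ler_pdivlMr// lerBrDr mulrC.
Qed.

Lemma cvg_std_Phiy : @std_Phi R x @[x --> +oo] --> (1 : R).
Proof.
(* The identity under the standard normal probability has [std_Phi] as its distribution function. *)
pose X : {RV (@normal_prob R 0 1) >-> R} := HB.pack (idfun : measurableTypeR R -> R)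
  (isMeasurableFun.Build _ _ (measurableTypeR R) R idfun (@measurable_id _ _ setT)).
have := cvg_cdfy1 X.
rewrite (_ : cdf X = EFin \o @std_Phi R); first by move/fine_cvg.
by apply/funext => x /=; rewrite std_PhiE.
Qed.

Lemma cvg_std_PhiNy : @std_Phi R x @[x --> -oo] --> (0 : R).
Proof.
pose X : {RV (@normal_prob R 0 1) >-> R} := HB.pack (idfun : measurableTypeR R -> R)
  (isMeasurableFun.Build _ _ (measurableTypeR R) R idfun (@measurable_id _ _ setT)).
have := cvg_cdfNy0 X.
rewrite (_ : cdf X = EFin \o @std_Phi R); first by move/fine_cvg.
by apply/funext => x /=; rewrite std_PhiE.
Qed.

Lemma cvg_std_Phi_pos (c : R) : 0 < c ->
  std_Phi (c * n.+1%:R) @[n --> \oo] --> (1 : R).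
Proof.
move=> c0; apply: (cvg_comp (fun n : nat => c * n.+1%:R) (@std_Phi R)) cvg_std_Phiy.
apply/cvgryPge => A; near=> n.
rewrite -ler_pdivrMl//; apply: (@le_trans _ _ n%:R); last by rewrite ler_nat.
by near: n; exact: nbhs_infty_ger.
Unshelve. all: by end_near. Qed.

Lemma cvg_std_Phi_neg (c : R) : c < 0 ->
  std_Phi (c * n.+1%:R) @[n --> \oo] --> (0 : R).
Proof.
move=> c0; apply: (cvg_comp (fun n : nat => c * n.+1%:R) (@std_Phi R)) cvg_std_PhiNy.
apply/cvgrNyPle => A; near=> n.
rewrite -ler_ndivrMl//; apply: (@le_trans _ _ n%:R); last by rewrite ler_nat.
by near: n; exact: nbhs_infty_ger.
Unshelve. all: by end_near. Qed.

End normal_cdf_limits.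

(** * Fourier uniqueness on the line by Gaussian smoothing *)

Section fourier_uniqueness.
Context d (T : measurableType d) (R : realType) (P : probability T R).
Notation mu := (@lebesgue_measure R).
Local Notation bm := bounded_measurable.
Local Notation Ex := (Rintegral P setT).
Variables (H X : T -> R).
Hypotheses (bH : bm H) (mX : measurable_fun setT X).
Hypothesis Hcos : forall s, Ex (fun t => H t * cos (s * X t)) = 0.
Hypothesis Hsin : forall s, Ex (fun t => H t * sin (s * X t)) = 0.

Let Hcos_shift (s v : R) : Ex (fun t => H t * cos (s * (X t - v))) = 0.
Proof.
have bc : bm (fun t => H t * cos (s * X t)).
  by apply: bmM => //; apply: bm_cos; exact: measurable_funM.
have bs : bm (fun t => H t * sin (s * X t)).
  by apply: bmM => //; apply: bm_sin; exact: measurable_funM.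
transitivity (Ex (fun t => cos (s * v) * (H t * cos (s * X t)) +
    sin (s * v) * (H t * sin (s * X t)))).
  by apply: eq_Rintegral => t _; rewrite mulrBr cosB; ring.
rewrite bmRintegralD; [|exact: bmZ|exact: bmZ].
by rewrite !bmRintegralZ// Hcos Hsin !mulr0 addr0.
Qed.

Let mXf : measurable_fun setT (fun z : T * measurableTypeR R => X z.1).
Proof. exact: measurableT_comp mX measurable_fst. Qed.

Let mHf : measurable_fun setT (fun z : T * measurableTypeR R => H z.1).
Proof. by case: bH => mH _; exact: measurableT_comp mH measurable_fst. Qed.

Let msnd : measurable_fun setT (fun z : T * measurableTypeR R => z.2 : R).
Proof. exact: measurable_snd. Qed.

(** Up to [normal_peak e], the density at [v] is the Gaussian Fourier transform at [(X - v) / e],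
    hence a mixture over [s] of the functions [cos (s / e * (X - v))], to each of which [H] is
    orthogonal. *)
Let H_normal (e v : R) : 0 < e -> Ex (fun t => H t * normal_pdf (X t) e v) = 0.
Proof.
move=> e0; have eN0 : e != 0 by rewrite gt_eqF.
have [mH [M M0 HM]] := bounded_measurable_ge0 bH.
pose h (z : T * measurableTypeR R) : R :=
  H z.1 * (cos (z.2 / e * (X z.1 - v)) * normal_pdf 0 1 z.2).
have iq := integrable_normal_pdf 0 (1 : R).
have hE t : \int[mu]_s h (t, s) = H t * expR (- ((X t - v) / e) ^+ 2 / 2).
  have ic : mu.-integrable setT (EFin \o (fun s : R => cos (s / e * (X t - v)) * normal_pdf 0 1 s)).
    apply: le_integrable iq => //.
    - apply: measurable_EFin_comp; apply: (@measurable_funM _ R).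
        apply: measurableT_comp.
          by apply: continuous_measurable_fun; exact: continuous_cos.
        by apply: measurable_funM => //; exact: measurable_funM.
      exact: measurable_normal_pdf.
    - by move=> s _; rewrite !abse_EFin lee_fin normrM ler_piMl// cos_norm_le1.
  rewrite /h/= RintegralZl//; congr (_ * _).
  transitivity (\int[mu]_s (cos ((X t - v) / e * s + 0) * normal_pdf 0 1 s)).
    by apply: eq_Rintegral => s _; congr (cos _ * _); rewrite addr0; ring.
  by rewrite gaussian_charfun// cos0 !mul1r.
transitivity (normal_peak e * Ex (fun t => \int[mu]_s h (t, s))).
  under [in RHS]eq_Rintegral do rewrite hE.
  have mE : measurable_fun setT (fun t => expR (- ((X t - v) / e) ^+ 2 / 2)).
    apply: measurableT_comp => //; apply: measurable_funM => //.
    apply: measurableT_comp => //; apply: measurable_funX; apply: measurable_funM => //.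
    exact: measurable_funB.
  rewrite -bmRintegralZ.
    apply: eq_Rintegral => t _; rewrite normal_pdf_expR// mulrCA; congr (_ * (_ * expR _)).
    by field.
  apply: bmM => //; split => //; exists 1 => t.
  rewrite ger0_norm ?expR_ge0// -[leRHS]expR0 ler_expR mulNr oppr_le0.
  by rewrite divr_ge0 ?sqr_ge0.
rewrite (@Rintegral_fubini0 _ _ _ P M h) ?mulr0//.
- rewrite /h; apply: measurable_funM => //; apply: measurable_funM.
    apply: measurableT_comp.
      by apply: continuous_measurable_fun; exact: continuous_cos.
    by apply: measurable_funM; [exact: measurable_funM|exact: measurable_funB].
  exact: measurableT_comp (measurable_normal_pdf 0 1) msnd.
- move=> t; apply: (@le_trans _ _ (\int[mu]_s (M%:E * (normal_pdf 0 1 s)%:E))%E).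
    apply: ge0_le_integral => //.
    + apply: measurable_EFin_comp; apply: (@measurableT_comp _ _ _ R) => //.
      rewrite /h/=; apply: (@measurable_funM _ R) => //; apply: (@measurable_funM _ R).
        apply: measurableT_comp.
          by apply: continuous_measurable_fun; exact: continuous_cos.
        by apply: measurable_funM => //; exact: measurable_funM.
      exact: measurable_normal_pdf.
    + by apply: measurable_funeM; exact: measurable_EFin_normal_pdf.
    + move=> s _; rewrite -EFinM lee_fin /h/= !normrM ler_pM ?mulr_ge0//.
      by rewrite (ger0_norm (normal_pdf_ge0 _ _ _)) ler_piMl ?normal_pdf_ge0// cos_norm_le1.
  by rewrite integralZl// integral_normal_pdf mule1.
- move=> s; rewrite /h/=; apply: bmM => //; apply: bmM; last exact: bm_cst.
  by apply: bm_cos; apply: measurable_funM => //; exact: measurable_funB.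
- move=> s; rewrite /h/=.
  transitivity (normal_pdf 0 1 s * Ex (fun t => H t * cos (s / e * (X t - v)))).
    rewrite -bmRintegralZ; first by apply: eq_Rintegral => t _; ring.
    by apply: bmM => //; apply: bm_cos; apply: measurable_funM => //; exact: measurable_funB.
  by rewrite Hcos_shift mulr0.
Qed.

(** Integrating the smoothed point mass of [H_normal] over [v <= b] gives a smoothed indicator of
    the ray up to [b]. *)
Let H_Phi (e b : R) : 0 < e -> Ex (fun t => H t * std_Phi ((b - X t) / e)) = 0.
Proof.
move=> e0; have eN0 : e != 0 by rewrite gt_eqF.
have [mH [M M0 HM]] := bounded_measurable_ge0 bH.
pose h (z : T * measurableTypeR R) : R :=
  H z.1 * (\1_(`]-oo, b]) (z.2 : R) * normal_pdf (X z.1) e z.2).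
have mn : measurable_fun setT (fun z : T * measurableTypeR R => normal_pdf (X z.1) e z.2).
  rewrite (_ : (fun z => _) = (fun z : T * measurableTypeR R =>
    normal_peak e * expR (- (z.2 - X z.1) ^+ 2 / (e ^+ 2 *+ 2)))); last first.
    by apply/funext => z; rewrite normal_pdf_expR.
  apply: measurable_funM => //; apply: measurableT_comp => //; apply: measurable_funM => //.
  by apply: measurableT_comp => //; apply: measurable_funX; exact: measurable_funB.
have i1 (a : R) : mu.-integrable setT (EFin \o (fun v : R => \1_(`]-oo, b]) v * normal_pdf a e v)).
  apply: le_integrable (integrable_normal_pdf a e) => //.
  - apply: measurable_EFin_comp; apply: (@measurable_funM _ R).
      exact: measurable_indic.
    exact: measurable_normal_pdf.
  - by move=> v _; rewrite !abse_EFin lee_fin normrM ler_piMl// indic_norm_le1.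
transitivity (Ex (fun t => \int[mu]_v h (t, v))).
  apply: eq_Rintegral => t _; rewrite /h/= (RintegralZl _ measurableT (i1 (X t))).
  by rewrite integral_normal_le.
apply: (@Rintegral_fubini0 _ _ _ P M h).
- rewrite /h; apply: measurable_funM => //; apply: measurable_funM => //.
  exact: (measurableT_comp (measurable_indic _) msnd).
- move=> t; apply: (@le_trans _ _ (\int[mu]_s (M%:E * (normal_pdf (X t) e s)%:E))%E).
    apply: ge0_le_integral => //.
    + apply: measurable_EFin_comp; apply: (@measurableT_comp _ _ _ R) => //.
      rewrite /h/=; apply: (@measurable_funM _ R) => //; apply: (@measurable_funM _ R).
        exact: measurable_indic.
      exact: measurable_normal_pdf.
    + by apply: measurable_funeM; exact: measurable_EFin_normal_pdf.
    + move=> s _; rewrite -EFinM lee_fin /h/= !normrM ler_pM ?mulr_ge0//.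
      by rewrite (ger0_norm (normal_pdf_ge0 _ _ _)) ler_piMl ?normal_pdf_ge0// indic_norm_le1.
  rewrite integralZl//; last exact: integrable_normal_pdf.
  by rewrite integral_normal_pdf mule1.
- move=> v; rewrite /h/=; apply: bmM => //; apply: bmM; first exact: bm_cst.
  split; first exact: (measurableT_comp mn (pair2_measurable v)).
  exists (normal_peak e) => t.
  by rewrite (ger0_norm (normal_pdf_ge0 _ _ _)) normal_pdf_ub.
- move=> v; rewrite /h/=.
  transitivity (\1_(`]-oo, b]) v * Ex (fun t => H t * normal_pdf (X t) e v)).
    rewrite -bmRintegralZ; first by apply: eq_Rintegral => t _; rewrite mulrCA.
    apply: bmM => //; split; first exact: (measurableT_comp mn (pair2_measurable v)).
    exists (normal_peak e) => t.
    by rewrite (ger0_norm (normal_pdf_ge0 _ _ _)) normal_pdf_ub.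
  by rewrite H_normal// mulr0.
Qed.

(** The pointwise limit of [std_Phi ((b - x) / e)] as [e] tends to 0 from above. At [x = b] the
    argument is 0 for every [e], whence the value [std_Phi 0]. *)
Let step (b x : R) : R := if x < b then 1 else if x == b then std_Phi 0 else 0.

Let H_step (b : R) : Ex (fun t => H t * step b (X t)) = 0.
Proof.
have [mH [M M0 HM]] := bounded_measurable_ge0 bH.
apply: (@Rintegral_cvg0 _ _ _ P M (fun n t => H t * std_Phi ((b - X t) / n.+1%:R^-1))).
- move=> n; apply: measurable_funM => //; apply: measurableT_comp.
    exact: measurable_std_Phi.
  by apply: measurable_funM => //; exact: measurable_funB.
- move=> n t; rewrite normrM (ger0_norm (std_Phi_ge0 _)) -[leRHS]mulr1.
  by rewrite ler_pM// ?std_Phi_ge0// std_Phi_le1.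
- move=> t; apply: cvgM; first exact: cvg_cst.
  rewrite /step; have [Xb|bX|->] := ltgtP (X t) b.
  + under eq_fun do rewrite invrK.
    by apply: cvg_std_Phi_pos; rewrite subr_gt0.
  + under eq_fun do rewrite invrK.
    by apply: cvg_std_Phi_neg; rewrite subr_lt0.
  + under eq_fun do rewrite subrr mul0r.
    exact: cvg_cst.
- by move=> n; apply: H_Phi.
Qed.

(** Jumps placed at [a - 1 / (n + 1)] increase to [a] strictly from below. Each point below [a]
    eventually lies before the jump, and each point from [a] on always lies after it, so the value
    at the jump leaves no trace in the limit. *)
Let H_lt (a : R) : Ex (fun t => H t * \1_(`]-oo, a[) (X t)) = 0.
Proof.
have [mH [M M0 HM]] := bounded_measurable_ge0 bH.
apply: (@Rintegral_cvg0 _ _ _ P M (fun n t => H t * step (a - n.+1%:R^-1) (X t))).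
- move=> n; apply: measurable_funM => //; rewrite /step.
  apply: measurable_fun_ifT => //; first exact: measurable_fun_ltr.
  apply: measurable_fun_ifT => //; exact: measurable_fun_eqr.
- move=> n t; rewrite normrM -[leRHS]mulr1 ler_pM// /step.
  case: ifP => _; first by rewrite normr1.
  by case: ifP => _; rewrite ?normr0// (ger0_norm (std_Phi_ge0 _)) std_Phi_le1.
- move=> t; apply: cvgM; first exact: cvg_cst.
  rewrite indicE mem_setE in_itv/=; have [Xa|aX] := ltP (X t) a.
  + apply: cvg_near_cst; near=> n; rewrite /step ifT//.
    rewrite ltrBrDr -ltrBrDl; near: n.
    by apply: near_infty_natSinv_lt (PosNum _); rewrite subr_gt0.
  + apply: cvg_near_cst; apply: nearW => n; rewrite /step.
    have h : a - n.+1%:R^-1 < X t by rewrite (lt_le_trans _ aX)// ltrBlDr ltrDl invr_gt0.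
    by rewrite ltNge (ltW h)/= gt_eqF.
- by move=> n; exact: H_step.
Unshelve. all: by end_near. Qed.

(** The open left rays are stable under intersection and generate the Borel sets, so Dynkin's
    theorem extends [H_lt] to all of them. *)
Lemma fourier_indic0 (C : set R) : measurable C ->
  Ex (fun t => H t * \1_C (X t)) = 0.
Proof.
have [mH [M M0 HM]] := bounded_measurable_ge0 bH.
have bHC (S : set R) : measurable S -> bm (fun t => H t * \1_S (X t)).
  by move=> mS; apply: bmM => //; exact: bm_indic.
(* The full line is the limit of the rays up to [n]; complements also reduce to this case. *)
have HT : Ex H = 0.
  apply: (@Rintegral_cvg0 _ _ _ P M (fun n t => H t * \1_(`]-oo, n%:R[) (X t))) => //.
  - by move=> n; apply: (bHC _ _).1.
  - by move=> n t; rewrite normrM -[leRHS]mulr1 ler_pM// indic_norm_le1.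
  - move=> t; rewrite -[X in _ --> X]mulr1; apply: cvgM; first exact: cvg_cst.
    apply: cvg_near_cst; near=> n; rewrite indicE mem_setE in_itv/=.
    by rewrite (_ : X t < n%:R)//; near: n; exact: nbhs_infty_gtr.
move=> mC; have {mC} : (@RGenInftyO.G R).-sigma.-measurable C.
  by rewrite -RGenInftyO.measurableE.
move: C; apply: (@dynkin_induction _ (measurableTypeR R) (@RGenInftyO.G R)).
- exact: RGenInftyO.measurableE.
- move=> _ _ [x ->] [y ->]; exists (Num.min x y).
  by apply/seteqP; split => z /=; rewrite !in_itv/= lt_min => /andP.
- by under eq_Rintegral do rewrite indicT mulr1.
- by move=> _ [x ->]; exact: H_lt.
- move=> S mS HS.
  transitivity (Ex (fun t => H t - H t * \1_S (X t))).
    apply: eq_Rintegral => t _; rewrite !indicE in_setC.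
    by case: (_ \in _); rewrite /= ?mulr0 ?mulr1 ?subrr ?subr0.
  by rewrite bmRintegralB// ?HS ?HT ?subr0//; exact: bHC.
- move=> F mF tF HF.
  have mU n : measurable (\bigcup_(k < n) F k) by exact: bigcup_measurable.
  (* Finite unions are additive by disjointness; the countable union is their bounded pointwise
     limit. *)
  have HU n : Ex (fun t => H t * \1_(\bigcup_(k < n) F k) (X t)) = 0.
    elim: n => [|n IH].
      under eq_Rintegral do rewrite bigcup_mkord big_ord0 indic0 mulr0.
      exact: Rintegral_prob_cst.
    transitivity (Ex (fun t => H t * \1_(\bigcup_(k < n) F k) (X t) + H t * \1_(F n) (X t))).
      apply: eq_Rintegral => t _; rewrite -mulrDr; congr (_ * _).
      rewrite bigcup_mkord big_ord_recr/= -bigcup_mkord !indicE in_setU.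
      have [h1|] := boolP (_ \in \bigcup_(k < n) F k); last by rewrite add0r.
      have [h2|] := boolP (_ \in F n); last by rewrite addr0.
      exfalso; move: h1 h2; rewrite !inE => -[k /= kn Fk] Fn.
      have := tF k n I I (ex_intro _ (X t) (conj Fk Fn)).
      by move=> kE; rewrite kE ltnn in kn.
    by rewrite (bmRintegralD P (bHC _ (mU n)) (bHC _ (mF n))) IH HF addr0.
  apply: (@Rintegral_cvg0 _ _ _ P M (fun n t => H t * \1_(\bigcup_(k < n) F k) (X t))) => //.
  - by move=> n; exact: (bHC _ (mU n)).1.
  - by move=> n t; rewrite normrM -[leRHS]mulr1 ler_pM// indic_norm_le1.
  - move=> t; apply: cvgM; first exact: cvg_cst.
    have [[k _ Fk]|nF] := pselect ((\bigcup_k F k) (X t)).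
      apply: cvg_near_cst; near=> n; rewrite !indicE !mem_set//; first by exists k.
      exists k => //=; near: n; exact: nbhs_infty_gt.
    apply: cvg_near_cst; apply: nearW => n; rewrite !indicE !memNset//.
    by move=> [k /= _ Fk]; apply: nF; exists k.
Unshelve. all: by end_near. Qed.

End fourier_uniqueness.

(** * Passing between boxes and cosines of linear forms *)

Section finite_dimensional.
Context d (T : measurableType d) (R : realType) (P : probability T R).
Notation mu := (@lebesgue_measure R).
Local Notation bm := bounded_measurable.
Local Notation Ex := (Rintegral P setT).

(* Layer cake: a bounded function is an integral of indicators of its level sets. *)
Lemma indic0_bounded_ge0 (H X : T -> R) (f : R -> R) (M : R) :
  bm H -> measurable_fun setT X ->
  (forall C : set R, measurable C -> Ex (fun t => H t * \1_C (X t)) = 0) ->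
  measurable_fun setT f -> (forall x, 0 <= f x <= M) ->
  Ex (fun t => H t * f (X t)) = 0.
Proof.
move=> bH mX H0 mf fM.
have [mH [K K0 HK]] := bounded_measurable_ge0 bH.
have M0 : 0 <= M by have /andP[f0 fM'] := fM 0; exact: le_trans fM'.
have f0 x : 0 <= f x by have /andP[] := fM x.
pose h (z : T * measurableTypeR R) : R :=
  H z.1 * (if 0 <= z.2 then if z.2 < f (X z.1) then 1 else 0 else 0).
have hE t r : h (t, r) = H t * \1_(`[0, f (X t)[) r.
  rewrite /h/= indicE mem_setE in_itv/=.
  by case: (0 <= r) => //=; case: (r < _).
have iI t : mu.-integrable setT (EFin \o (fun r : R => \1_(`[0, f (X t)[) r)).
  apply/integrableP; split.
    by apply: measurable_EFin_comp; exact: measurable_indic.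
  under eq_integral do rewrite /= ger0_norm//.
  by rewrite integral_indic// setIT /= lebesgue_measure_itv/=; case: ifP => _; rewrite ltry.
have I1E t : (\int[mu]_r (\1_(`[0%R, f (X t)[) r)%:E = (f (X t))%:E)%E.
  rewrite integral_indic// setIT /= lebesgue_measure_itv/= lte_fin.
  have [_|] := ltP 0 (f (X t)); first by rewrite oppr0 adde0.
  by move=> fX0; congr EFin; apply/eqP; rewrite eq_le f0 fX0.
have I1 t : \int[mu]_r \1_(`[0, f (X t)[) r = f (X t) by rewrite /Rintegral I1E.
transitivity (Ex (fun t => \int[mu]_r h (t, r))).
  apply: eq_Rintegral => t _; under [in RHS]eq_Rintegral do rewrite hE.
  by rewrite (RintegralZl _ measurableT (iI t)) I1.
apply: (@Rintegral_fubini0 _ _ _ P (K * M) h).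
- have ms : measurable_fun setT (fun z : T * measurableTypeR R => z.2 : R) by exact: measurable_snd.
  have mfX : measurable_fun setT (fun z : T * measurableTypeR R => f (X z.1)).
    by apply: measurableT_comp => //; exact: measurableT_comp mX measurable_fst.
  apply: measurable_funM; first exact: measurableT_comp mH measurable_fst.
  apply: measurable_fun_ifT => //; first exact: measurable_fun_ler.
  by apply: measurable_fun_ifT => //; exact: measurable_fun_ltr.
- move=> t; have hN r : `|h (t, r)|%:E = (`|H t|%:E * (\1_(`[0%R, f (X t)[) r)%:E)%E.
    by rewrite hE normrM EFinM; congr (_ * _%:E)%E; rewrite ger0_norm.
  under eq_integral do rewrite hN.
  rewrite ge0_integralZl//; last exact: measurable_EFin_indic.
  rewrite EFinM lee_pmul//; [|by rewrite lee_fin|].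
    by apply: integral_ge0 => r _; rewrite lee_fin.
  rewrite [X in (X <= _)%E](_ : _ = (f (X t))%:E)%E; last exact: I1E.
  by rewrite lee_fin; have /andP[] := fM (X t).
- move=> r; split.
    apply: measurable_funM => //; apply: measurable_fun_ifT => //=.
    by apply: measurable_fun_ifT => //; apply: measurable_fun_ltr => //; exact: measurableT_comp.
  by exists K => t; rewrite hE normrM -[leRHS]mulr1 ler_pM// indic_norm_le1.
- move=> r; have [r0|r0] := leP 0 r; last first.
    under eq_Rintegral do rewrite /h/= leNgt r0/= mulr0.
    exact: Rintegral_prob_cst.
  have mC : measurable [set x : R | r < f x].
    rewrite -[X in measurable X]setTI.
    rewrite (_ : [set x | r < f x] = f @^-1` `]r, +oo[); first exact: mf.
    by apply/seteqP; split => x /=; rewrite in_itv/= andbT.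
  rewrite -[RHS](H0 _ mC); apply: eq_Rintegral => t _.
  rewrite /h/= r0 indicE; congr (_ * _).
  have -> : (X t \in [set x | r < f x]) = (r < f (X t)) by apply/idP/idP; rewrite inE.
  by case: (r < _).
Qed.

(** Adding [M] makes [f] nonnegative, and the added constant is harmless because [C = setT] gives
    [Ex H = 0]. *)
Lemma indic0_bounded (H X : T -> R) (f : R -> R) (M : R) :
  bm H -> measurable_fun setT X ->
  (forall C : set R, measurable C -> Ex (fun t => H t * \1_C (X t)) = 0) ->
  measurable_fun setT f -> (forall x, `|f x| <= M) ->
  Ex (fun t => H t * f (X t)) = 0.
Proof.
move=> bH mX H0 mf fM.
have h1 : Ex (fun t => H t * (f (X t) + M)) = 0.
  apply: (@indic0_bounded_ge0 H X (fun x => f x + M) (M + M)) => //.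
    exact: measurable_funD.
  move=> x; have := fM x; rewrite ler_norml => /andP[f1 f2].
  by rewrite -lerBlDr sub0r f1 lerD2r.
have h2 : Ex (fun t => M * H t) = 0.
  rewrite bmRintegralZ// -[X in _ * X](_ : Ex (fun t => H t * \1_setT (X t)) = _).
    by rewrite H0// mulr0.
  by apply: eq_Rintegral => t _; rewrite indicT mulr1.
transitivity (Ex (fun t => H t * (f (X t) + M) - M * H t)).
  by apply: eq_Rintegral => t _; ring.
have bf : bm (fun t => f (X t)) by split; [exact: measurableT_comp|exists M].
rewrite bmRintegralB ?h1 ?h2 ?subr0//.
- by apply: bmM => //; apply: bmD => //; exact: bm_cst.
- exact: bmZ.
Qed.

Variable X : nat -> T -> R.
Hypothesis mX : forall i, measurable_fun setT (X i).

Let mlin n (al : nat -> R) (th : R) :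
  measurable_fun setT (fun t => \sum_(i < n) al i * X i t + th).
Proof.
by apply: measurable_funD => //; apply: measurable_sum => i; exact: measurable_funM.
Qed.

(** Induction on [n] with [H] general: the indicator of the last coordinate is absorbed into [H],
    the others become a cosine by induction, and the last indicator is then traded for
    [cos (al n * x)] and [sin (al n * x)], which the addition formula recombines. *)
Lemma cos0_of_rect0 n (H : T -> R) : bm H ->
  (forall C : nat -> set R, (forall i, measurable (C i)) ->
    Ex (fun t => H t * \prod_(i < n) \1_(C i) (X i t)) = 0) ->
  forall (al : nat -> R) (th : R),
    Ex (fun t => H t * cos (\sum_(i < n) al i * X i t + th)) = 0.
Proof.
elim: n H => [|n IH] H bH HC al th.
  have := HC (fun=> setT) (fun=> measurableT).
  under eq_Rintegral do rewrite big_ord0 mulr1.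
  move=> EH; under eq_Rintegral do rewrite big_ord0 add0r mulrC.
  by rewrite bmRintegralZ// EH mulr0.
have key th' (C : set R) : measurable C ->
    Ex (fun t => H t * cos (\sum_(i < n) al i * X i t + th') * \1_C (X n t)) = 0.
  move=> mC; transitivity (Ex (fun t => (H t * \1_C (X n t)) *
      cos (\sum_(i < n) al i * X i t + th'))).
    by apply: eq_Rintegral => t _; ring.
  apply: IH; first by apply: bmM => //; exact: bm_indic.
  move=> C' mC'; rewrite -[RHS](HC (fun i => if (i == n)%N then C else C' i)); last first.
    by move=> i; case: ifP.
  apply: eq_Rintegral => t _; rewrite big_ord_recr/= eqxx -mulrA; congr (_ * _).
  rewrite mulrC; congr (_ * _); apply: eq_bigr => i _.
  by rewrite (ltn_eqF (ltn_ord i)).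
have bHc th' : bm (fun t => H t * cos (\sum_(i < n) al i * X i t + th')).
  by apply: bmM => //; exact: bm_cos.
have mc : measurable_fun setT (fun x : R => cos (al n * x)).
  apply: measurableT_comp; last exact: measurable_funM.
  by apply: continuous_measurable_fun; exact: continuous_cos.
have ms : measurable_fun setT (fun x : R => sin (al n * x)).
  apply: measurableT_comp; last exact: measurable_funM.
  by apply: continuous_measurable_fun; exact: continuous_sin.
have hc := indic0_bounded (bHc th) (mX n) (key th) mc (fun x => cos_norm_le1 _).
(* Shifting the phase by [- pi / 2] turns the cosine of the remaining coordinates into the sine
   required by the addition formula. *)
have hs := indic0_bounded (bHc (th - pi / 2)) (mX n) (key (th - pi / 2)) ms
  (fun x => sin_norm_le1 _).
transitivity (Ex (fun t => H t * cos (\sum_(i < n) al i * X i t + th) * cos (al n * X n t) -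
   H t * cos (\sum_(i < n) al i * X i t + (th - pi / 2)) * sin (al n * X n t))).
  apply: eq_Rintegral => t _; rewrite big_ord_recr/= addrA cosBpihalf.
  by rewrite addrAC cosD; ring.
rewrite bmRintegralB ?hc ?hs ?subrr//; apply: bmM => //.
- by apply: bm_cos; exact: measurable_funM.
- by apply: bm_sin; exact: measurable_funM.
Qed.

(** The last indicator is again absorbed into [H]. The new [H] is orthogonal to the cosines in the
    remaining coordinates by one-dimensional uniqueness in [X n], applied to [H] times such a
    cosine. *)
Lemma rect0_of_cos0 n (H : T -> R) : bm H ->
  (forall (al : nat -> R) (th : R),
    Ex (fun t => H t * cos (\sum_(i < n) al i * X i t + th)) = 0) ->
  forall C : nat -> set R, (forall i, measurable (C i)) ->
    Ex (fun t => H t * \prod_(i < n) \1_(C i) (X i t)) = 0.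
Proof.
elim: n H => [|n IH] H bH HC C mC.
  have := HC (fun=> 0) 0.
  under eq_Rintegral do rewrite big_ord0 addr0 cos0.
  by under [in X in _ -> X]eq_Rintegral do rewrite big_ord0.
transitivity (Ex (fun t => H t * \1_(C n) (X n t) * \prod_(i < n) \1_(C i) (X i t))).
  by apply: eq_Rintegral => t _; rewrite big_ord_recr/=; ring.
apply: IH => //; first by apply: bmM => //; exact: bm_indic.
move=> al th.
transitivity (Ex (fun t => H t * cos (\sum_(i < n) al i * X i t + th) * \1_(C n) (X n t))).
  by apply: eq_Rintegral => t _; ring.
have bHc s th' : bm (fun t => H t * cos (\sum_(i < n) al i * X i t + s * X n t + th')).
  apply: bmM => //; apply: bm_cos; apply: measurable_funD => //.
  apply: measurable_funD; last exact: measurable_funM.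
  by apply: measurable_sum => i; exact: measurable_funM.
have E0 s th' : Ex (fun t => H t * cos (\sum_(i < n) al i * X i t + s * X n t + th')) = 0.
  rewrite -[RHS](HC (fun i => if (i == n)%N then s else al i) th').
  apply: eq_Rintegral => t _; rewrite big_ord_recr/= eqxx; congr (_ * cos (_ + _ + _)).
  by apply: eq_bigr => i _; rewrite (ltn_eqF (ltn_ord i)).
(* Product-to-sum formulas: [c = 1 / 2] produces the product with [cos (s * X n t)], and
   [c = - 1 / 2] with phase [th - pi / 2] the product with [sin (s * X n t)]. *)
have half0 s th1 th2 c : Ex (fun t => 2^-1 *
    (H t * cos (\sum_(i < n) al i * X i t + s * X n t + th1)) +
    c * (H t * cos (\sum_(i < n) al i * X i t + - s * X n t + th2))) = 0.
  rewrite bmRintegralD; [|exact: bmZ|exact: bmZ].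
  by rewrite !bmRintegralZ// !E0 !mulr0 addr0.
apply: fourier_indic0 => //.
- by apply: bmM => //; exact: bm_cos.
- move=> s; rewrite -[RHS](half0 s th th 2^-1); apply: eq_Rintegral => t _.
  move: (\sum_(i < n) _) => L.
  have -> : L + s * X n t + th = L + th + s * X n t by ring.
  have -> : L + - s * X n t + th = L + th - s * X n t by ring.
  by rewrite (cosD (L + th)) (cosB (L + th)); field.
- move=> s; rewrite -[RHS](half0 s (th - pi / 2) (th - pi / 2) (- 2^-1)).
  apply: eq_Rintegral => t _; rewrite !addrA !cosBpihalf.
  move: (\sum_(i < n) _) => L.
  have -> : L + s * X n t + th = L + th + s * X n t by ring.
  have -> : L + - s * X n t + th = L + th - s * X n t by ring.
  by rewrite (sinD (L + th)) (sinB (L + th)); field.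
Qed.

End finite_dimensional.

(** * An independent pair with a normal second component *)

Section independent_pair.
Context d (T : measurableType d) (R : realType) (P : probability T R).
Notation mu := (@lebesgue_measure R).
Variables (U X : T -> R).
Hypotheses (mU : measurable_fun setT U) (mX : measurable_fun setT X).
Hypothesis indep : forall A B : set R, measurable A -> measurable B ->
  P (U @^-1` A `&` X @^-1` B) = (P (U @^-1` A) * P (X @^-1` B))%E.

(** Independence says that the joint law agrees with the product of the marginals on rectangles,
    hence everywhere; the rest is Tonelli. *)
Lemma ge0_integral_indep (g : R * R -> \bar R) : measurable_fun setT g ->
  (forall z, 0 <= g z)%E ->
  (\int[P]_t g (U t, X t) = \int[P]_t \int[P]_t' g (U t, X t'))%E.
Proof.
move=> mg g0.
pose U' : {RV P >-> R} := HB.pack U (isMeasurableFun.Build _ _ _ _ _ mU).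
pose X' : {RV P >-> R} := HB.pack X (isMeasurableFun.Build _ _ _ _ _ mX).
have mZ : measurable_fun setT (fun t => (U t, X t)) by exact: measurable_fun_pair.
transitivity (\int[distribution P U' \x distribution P X']_z g z)%E.
  transitivity (\int[pushforward P (fun t => (U t, X t))]_z g z)%E.
    by rewrite ge0_integral_pushforward.
  apply: eq_measure_integral => A mA _; apply/esym.
  apply: product_measure_unique => // B C mB mC.
rewrite fubini_tonelli1//.
rewrite ge0_integral_distribution//; last 2 first.
- exact: measurable_fun_fubini_tonelli_F.
- by move=> x; exact: integral_ge0.
apply: eq_integral => t _.
apply: (@ge0_integral_pushforward _ _ T R R X mX P setT (fun y => g (U t, y))) => //.
exact: (measurableT_comp mg (pair1_measurable _)).
Qed.

Variables (e : R -> R) (c s : R).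
Hypotheses (me : measurable_fun setT e) (e0 : forall u, 0 <= e u) (s0 : 0 < s).
Hypothesis lawU : forall A : set R, measurable A ->
  P (U @^-1` A) = (\int[mu]_(x in A) (e x)%:E)%E.
Hypothesis lawX : forall A : set R, measurable A ->
  P (X @^-1` A) = (\int[mu]_(x in A) (normal_pdf 0 s x)%:E)%E.

(** For a frozen [u], the variable [c * u + X] is normal with mean [c * u]. The two inner integrals
    are compared by reducing both to the standard normal density. *)
Lemma ge0_integral_normal_shift (G : R * R -> \bar R) : measurable_fun setT G ->
  (forall z, 0 <= G z)%E ->
  (\int[P]_t G (U t, (c * U t + X t)%R) =
   \int[mu]_u ((\int[mu]_v (G (u, v) * (normal_pdf (c * u) s v)%:E)) * (e u)%:E))%E.
Proof.
move=> mG G0.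
pose g (z : R * R) := G (z.1, c * z.1 + z.2).
have mg : measurable_fun setT g.
  apply: measurableT_comp => //; apply: measurable_fun_pair => //.
  by apply: measurable_funD => //; apply: measurable_funM.
rewrite (ge0_integral_indep mg); last by move=> z; exact: G0.
pose F u := (\int[P]_t g (u, X t))%E.
have mF : measurable_fun setT F.
  apply: (@measurable_fun_fubini_tonelli_F _ _ R T R P (fun z => g (z.1, X z.2)));
    last by move=> z; exact: G0.
  apply: measurableT_comp => //; apply: measurable_fun_pair => //.
  exact: measurableT_comp mX measurable_snd.
rewrite (@ge0_integral_density _ _ _ P U e mU me e0 lawU F mF); last first.
  by move=> u; apply: integral_ge0 => t _; exact: G0.
apply: eq_integral => u _; congr (_ * _)%E.
have mGu : measurable_fun setT (fun v : R => G (u, v)).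
  exact: (measurableT_comp mG (pair1_measurable u)).
have mgu : measurable_fun setT (fun v : R => g (u, v)).
  exact: (measurableT_comp mg (pair1_measurable u)).
have g0u v : (0 <= g (u, v))%E by exact: G0.
have G0u v : (0 <= G (u, v))%E by exact: G0.
have -> : F u = (\int[mu]_v (g (u, v) * (normal_pdf 0 s v)%:E))%E.
  exact: (ge0_integral_density mX (measurable_normal_pdf _ _) (normal_pdf_ge0 _ _) lawX mgu).
rewrite (ge0_integral_normal_std 0 s0 mgu g0u).
rewrite (ge0_integral_normal_std (c * u) s0 mGu G0u).
by apply: eq_integral => v _; rewrite /g/= addr0 addrC.
Qed.

End independent_pair.

(** * The truncated normal kernel and the exponential density *)

Section truncated_normal.
Context {R : realType}.
Notation mu := (@lebesgue_measure R).
Implicit Types a s u v : R.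

(** Writing the variance as [s ^+ 2] removes the square roots in [tn_pdf]; later statements keep
    this form. *)
Lemma tn_pdfE a s u : 0 < s ->
  tn_pdf a (s ^+ 2) u = \1_(`]0, +oo[) u * (normal_pdf a s u / std_Phi (a / s)).
Proof.
move=> s0; rewrite /tn_pdf sqrtr_sqr gtr0_norm// indicE mem_setE in_itv/= andbT.
by case: ifP; rewrite ?mul1r ?mul0r.
Qed.

Lemma tn_pdf_ge0 a s u : 0 < s -> 0 <= tn_pdf a (s ^+ 2) u.
Proof.
by move=> s0; rewrite tn_pdfE// !mulr_ge0 ?normal_pdf_ge0// invr_ge0 std_Phi_ge0.
Qed.

Lemma measurable_tn_pdf s : 0 < s ->
  measurable_fun setT (fun z : R * R => tn_pdf z.1 (s ^+ 2) z.2).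
Proof.
move=> s0; have sN0 : s != 0 by rewrite gt_eqF.
have m2 : measurable_fun setT (fun z : R * R => z.2) by exact: measurable_snd.
have m1 : measurable_fun setT (fun z : R * R => z.1) by exact: measurable_fst.
rewrite (_ : (fun z => _) = fun z : R * R => \1_(`]0, +oo[) z.2 *
  (normal_peak s * expR (- (z.2 - z.1) ^+ 2 / (s ^+ 2 *+ 2)) / std_Phi (z.1 / s))); last first.
  by apply/funext => z; rewrite tn_pdfE// normal_pdf_expR.
apply: measurable_funM.
  by apply: (measurableT_comp _ m2); exact: measurable_indic.
apply: measurable_funM.
  apply: measurable_funM => //; apply: measurableT_comp => //.
  apply: measurable_funM => //; apply: measurableT_comp => //.
  by apply: measurable_funX; exact: measurable_funB.
(* The reciprocal of the positive function [std_Phi] is rewritten through [expR] and [ln], whose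
   measurability is at hand. *)
rewrite (_ : (fun z => _) = (fun z : R * R => expR (- ln (std_Phi (z.1 / s))))); last first.
  by apply/funext => z; rewrite expRN lnK// posrE std_Phi_gt0.
apply: measurableT_comp => //; apply: measurableT_comp => //.
apply: measurableT_comp; first exact: measurable_ln.
apply: measurableT_comp; first exact: measurable_std_Phi.
exact: measurable_funM.
Qed.

Lemma measurable_EFin_tn_pdf a s : 0 < s ->
  measurable_fun [set: R] (fun u => (tn_pdf a (s ^+ 2) u)%:E).
Proof.
move=> s0; apply: measurable_EFin_comp.
exact: (measurableT_comp (measurable_tn_pdf s0) (pair1_measurable a)).
Qed.

Lemma integral_tn_pdf a s : 0 < s ->
  (\int[mu]_u (tn_pdf a (s ^+ 2) u)%:E = 1)%E.
Proof.
move=> s0.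
transitivity ((std_Phi (a / s))^-1%:E *
   \int[mu]_u ((\1_(`]0%R, +oo[) u)%:E * (normal_pdf a s u)%:E))%E.
  rewrite -ge0_integralZl//.
  - by apply: eq_integral => u _; rewrite tn_pdfE// -!EFinM; congr EFin; ring.
  - apply: (@emeasurable_funM _ R); last exact: measurable_EFin_normal_pdf.
    exact: measurable_EFin_indic.
  - by move=> u _; rewrite mule_ge0 ?lee_fin// normal_pdf_ge0.
  - by rewrite lee_fin invr_ge0 std_Phi_ge0.
rewrite -integral_indicM integral_normal_gt0// -EFinM mulVf// gt_eqF//.
exact: std_Phi_gt0.
Qed.

Lemma tn_prob_ge0 a s (B : set R) : 0 < s -> (0 <= tn_prob a (s ^+ 2) B)%E.
Proof. by move=> s0; apply: integral_ge0 => u _; rewrite lee_fin tn_pdf_ge0. Qed.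

Lemma tn_prob_le1 a s (B : set R) : 0 < s -> measurable B ->
  (tn_prob a (s ^+ 2) B <= 1)%E.
Proof.
move=> s0 mB; rewrite -(integral_tn_pdf a s0).
apply: ge0_subset_integral => //; first exact: measurable_EFin_tn_pdf.
by move=> u _; rewrite lee_fin tn_pdf_ge0.
Qed.

Lemma tn_prob_fin_num a s (B : set R) : 0 < s -> measurable B ->
  tn_prob a (s ^+ 2) B \is a fin_num.
Proof.
move=> s0 mB; rewrite ge0_fin_numE ?tn_prob_ge0//.
by rewrite (le_lt_trans (tn_prob_le1 _ s0 mB))// ltry.
Qed.

Lemma measurable_tn_prob s (B : set R) : 0 < s -> measurable B ->
  measurable_fun setT (fun a => tn_prob a (s ^+ 2) B).
Proof.
move=> s0 mB.
rewrite (_ : (fun a => _) = (fun a => (\int[mu]_u ((\1_B u)%:E * (tn_pdf a (s ^+ 2) u)%:E))%E));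
  last by apply/funext => a; rewrite /tn_prob integral_indicM.
pose f (z : R * measurableTypeR R) := ((\1_B (z.2 : R))%:E * (tn_pdf z.1 (s ^+ 2) z.2)%:E : \bar R)%E.
apply: (@measurable_fun_fubini_tonelli_F _ _ R (measurableTypeR R) R mu f).
  apply: emeasurable_funM.
    exact: (measurableT_comp (measurable_EFin_indic mB) measurable_snd).
  exact: (measurable_EFin_comp (measurable_tn_pdf s0)).
by move=> z; rewrite mule_ge0 ?lee_fin ?tn_pdf_ge0.
Qed.

(** This version vanishes at 0, as [tn_pdf] does, so the density form of Bayes' formula holds at
    every point. *)
Definition exp_density (u : R) : R := \1_(`]0, +oo[) u * expR (- u).

Lemma exp_density_ge0 u : 0 <= exp_density u.
Proof. by rewrite mulr_ge0// expR_ge0. Qed.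

Lemma measurable_exp_density : measurable_fun setT exp_density.
Proof.
apply: measurable_funM; first exact: measurable_indic.
by apply: measurableT_comp => //; exact: measurable_oppr.
Qed.

(* The two densities differ at 0 only. *)
Lemma exponential_prob_exp_density (B : set R) : measurable B ->
  exponential_prob 1 B = (\int[mu]_(u in B) (exp_density u)%:E)%E.
Proof.
move=> mB; rewrite /exponential_prob; apply: ae_eq_integral => //.
- apply: measurable_funTS; apply: measurable_EFin_comp; exact: measurable_exponential_pdf.
- apply: measurable_funTS; apply: measurable_EFin_comp; exact: measurable_exp_density.
- exists [set (0 : R)]; split => //; first exact: lebesgue_measure_set1.
  move=> u /=; apply: contra_notP => u0 _.
  congr EFin; rewrite /exp_density indicE mem_setE in_itv/= andbT.
  have [u1|u1] := ltP 0 u.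
    by rewrite exponential_pdfE ?ltW// !mul1r mulN1r.
  rewrite mul0r lt0_exponential_pdf// lt_neqAle u1 andbT.
  by apply/eqP.
Qed.

(** Completing the square in [u]: [(v - eta^2 u)^2 / (2 eta^2) + u] equals [eta^2 / 2 * (u - (v - 1)
    / eta^2)^2 + (2 v - 1) / (2 eta^2)]. *)
Lemma exp_normal_factor (eta u v : R) : 0 < eta ->
  normal_pdf (eta ^+ 2 * u) eta v * expR (- u) =
  normal_peak eta / normal_peak eta^-1 * expR ((1 - 2 * v) / (2 * eta ^+ 2)) *
  normal_pdf (eta^-1 * (eta^-1 * (v - 1))) eta^-1 u.
Proof.
move=> eta0; have etaN0 : eta != 0 by rewrite gt_eqF.
have eta'N0 : eta^-1 != 0 by rewrite invr_eq0.
have pN0 : normal_peak eta^-1 != 0 by rewrite gt_eqF ?normal_peak_gt0.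
rewrite !normal_pdf_expR// -[LHS]mulrA -expRD.
rewrite [RHS](_ : _ = normal_peak eta * (expR ((1 - 2 * v) / (2 * eta ^+ 2)) *
   expR (- (u - eta^-1 * (eta^-1 * (v - 1))) ^+ 2 / (eta^-1 ^+ 2 *+ 2)))); last first.
  by field.
by rewrite -expRD; congr (_ * expR _); field.
Qed.

End truncated_normal.

(** * Bayes' formula for the exponential variable and its noisy observation *)

Section bayes.
Context d (T : measurableType d) (R : realType) (P : probability T R).
Notation mu := (@lebesgue_measure R).
Local Notation bm := bounded_measurable.
Local Notation Ex := (Rintegral P setT).
Variables (U X : T -> R) (eta : R).
Hypotheses (mU : measurable_fun setT U) (mX : measurable_fun setT X) (eta0 : 0 < eta).
Hypothesis indep : forall A B : set R, measurable A -> measurable B ->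
  P (U @^-1` A `&` X @^-1` B) = (P (U @^-1` A) * P (X @^-1` B))%E.
Hypothesis lawU : forall A : set R, measurable A ->
  P (U @^-1` A) = exponential_prob 1 A.
Hypothesis lawX : forall A : set R, measurable A ->
  P (X @^-1` A) = normal_prob 0 eta A.

Let S t := eta ^+ 2 * U t + X t.
(** [w] is the joint density of [(U, S)], and [loc v] is the location [A / eta] of the truncated
    normal law as a function of the value [v] of [S]. *)
Let w u v := normal_pdf (eta ^+ 2 * u) eta v * exp_density u.
Let loc v := eta^-1 * (eta^-1 * (v - 1)).

Let w0 u v : 0 <= w u v.
Proof. by rewrite mulr_ge0 ?normal_pdf_ge0 ?exp_density_ge0. Qed.

Let mw : measurable_fun setT (fun z : R * R => (w z.1 z.2)%:E : \bar R).
Proof.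
have etaN0 : eta != 0 by rewrite gt_eqF.
apply: measurable_EFin_comp; apply: measurable_funM; last first.
  exact: measurableT_comp measurable_exp_density measurable_fst.
rewrite (_ : (fun z => _) = fun z : R * R =>
  normal_peak eta * expR (- (z.2 - eta ^+ 2 * z.1) ^+ 2 / (eta ^+ 2 *+ 2))); last first.
  by apply/funext => z; rewrite normal_pdf_expR.
apply: measurable_funM => //; apply: measurableT_comp => //; apply: measurable_funM => //.
apply: measurableT_comp => //; apply: measurable_funX; apply: measurable_funB => //.
exact: measurable_funM.
Qed.

Let ge0_integral_joint (G : R * R -> \bar R) : measurable_fun setT G ->
  (forall z, 0 <= G z)%E ->
  (\int[P]_t G (U t, S t) = \int[mu]_v \int[mu]_u (G (u, v) * (w u v)%:E))%E.
Proof.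
move=> mG G0.
rewrite (ge0_integral_normal_shift mU mX indep (eta ^+ 2) measurable_exp_density
  exp_density_ge0 eta0 _ lawX mG G0); last first.
  by move=> A mA; rewrite lawU// exponential_prob_exp_density.
pose f (z : measurableTypeR R * measurableTypeR R) := (G z * (w z.1 z.2)%:E)%E.
have mf : measurable_fun setT f by exact: (emeasurable_funM mG mw).
rewrite -(@fubini_tonelli _ _ _ _ _ mu mu f mf); last first.
  by move=> z; rewrite mule_ge0// lee_fin.
apply: eq_integral => u _; rewrite -ge0_integralZr//.
- by apply: eq_integral => v _; rewrite -muleA -EFinM.
- apply: (@emeasurable_funM _ R); last exact: measurable_EFin_normal_pdf.
  exact: (measurableT_comp mG (pair1_measurable u)).
- by move=> v _; rewrite mule_ge0// lee_fin normal_pdf_ge0.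
- by rewrite lee_fin exp_density_ge0.
Qed.

Let wE u v : w u v =
  normal_peak eta / normal_peak eta^-1 * expR ((1 - 2 * v) / (2 * eta ^+ 2)) *
  std_Phi (loc v / eta^-1) * tn_pdf (loc v) (eta^-1 ^+ 2) u.
Proof.
rewrite /w /exp_density mulrCA exp_normal_factor// tn_pdfE ?invr_gt0//.
have := std_Phi_gt0 (loc v / eta^-1); rewrite -/(loc v).
have : 0 < normal_peak eta^-1 by rewrite normal_peak_gt0// gt_eqF// invr_gt0.
move: (std_Phi _) (normal_peak eta^-1) => q pk pk0 q0.
by field; rewrite !gt_eqF.
Qed.

(** Bayes' formula with the denominator multiplied out. By [wE], the factor [L] of [w] that does not
    involve [u] is the marginal density of [S] at [v], because [tn_pdf] integrates to 1. *)
Let integral_w v (B : set R) : measurable B ->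
  (\int[mu]_u ((\1_B u)%:E * (w u v)%:E) =
   tn_prob (loc v) (eta^-1 ^+ 2) B * \int[mu]_u (w u v)%:E)%E.
Proof.
move=> mB; have eta'0 : 0 < eta^-1 by rewrite invr_gt0.
pose L := normal_peak eta / normal_peak eta^-1 * expR ((1 - 2 * v) / (2 * eta ^+ 2)) *
  std_Phi (loc v / eta^-1).
have L0 : (0 <= L%:E)%E.
  by rewrite lee_fin !mulr_ge0 ?invr_ge0 ?normal_peak_ge0 ?expR_ge0 ?std_Phi_ge0.
have tn0 u : (0 <= (tn_pdf (loc v) (eta^-1 ^+ 2) u)%:E)%E by rewrite lee_fin tn_pdf_ge0.
have -> : (\int[mu]_u (w u v)%:E = L%:E)%E.
  transitivity (L%:E * \int[mu]_u (tn_pdf (loc v) (eta^-1 ^+ 2) u)%:E)%E.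
    rewrite -ge0_integralZl//; last exact: measurable_EFin_tn_pdf.
    by apply: eq_integral => u _; rewrite wE EFinM.
  by rewrite integral_tn_pdf// mule1.
rewrite muleC /tn_prob [X in _ = (_ * X)%E]integral_indicM -ge0_integralZl//.
- by apply: eq_integral => u _; rewrite wE -/L EFinM muleCA.
- apply: (@emeasurable_funM _ R); last exact: measurable_EFin_tn_pdf.
  exact: measurable_EFin_indic.
- by move=> u _; rewrite mule_ge0.
Qed.

(** Both terms are integrated against [w] with [u] innermost; for each fixed [v] the inner integrals
    agree by [integral_w]. *)
Lemma bayes_exponential_normal (B C : set R) : measurable B -> measurable C ->
  Ex (fun t => (\1_B (U t) - fine (tn_prob (loc (S t)) (eta^-1 ^+ 2) B)) * \1_C (S t)) = 0.
Proof.
move=> mB mC; have eta'0 : 0 < eta^-1 by rewrite invr_gt0.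
pose K v := tn_prob (loc v) (eta^-1 ^+ 2) B.
have K0 v : (0 <= K v)%E by exact: tn_prob_ge0.
have Kfin v : K v \is a fin_num by exact: tn_prob_fin_num.
have mK : measurable_fun setT K.
  apply: (measurableT_comp (measurable_tn_prob eta'0 mB)).
  by apply: measurable_funM => //; apply: measurable_funM => //; exact: measurable_funB.
have mS : measurable_fun setT S.
  by apply: measurable_funD => //; exact: measurable_funM.
have bK : bm (fun t => fine (K (S t))).
  split.
    apply: (@measurableT_comp _ _ _ _ _ _ (fine \o K)) => //.
    exact: measurableT_comp.
  exists 1 => t; rewrite ger0_norm ?fine_ge0// -lee_fin fineK//.
  exact: tn_prob_le1.
have bB := bm_indic mU mB; have bC := bm_indic mS mC.
transitivity (Ex (fun t => \1_B (U t) * \1_C (S t)) - Ex (fun t => fine (K (S t)) * \1_C (S t))).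
  by rewrite -bmRintegralB; [apply: eq_Rintegral => t _; rewrite mulrBl|exact: bmM|exact: bmM].
apply/eqP; rewrite subr_eq0; apply/eqP; congr fine.
transitivity (\int[P]_t (((\1_B (U t))%:E * (\1_C (S t))%:E) : \bar R))%E.
  by apply: eq_integral => t _; rewrite EFinM.
transitivity (\int[P]_t (K (S t) * (\1_C (S t))%:E))%E; last first.
  by apply: eq_integral => t _; rewrite EFinM fineK.
have m1 : measurable_fun setT (fun z : R * R => (\1_B z.1)%:E : \bar R).
  exact: (measurableT_comp (measurable_EFin_indic mB) measurable_fst).
have m2 : measurable_fun setT (fun z : R * R => (\1_C z.2)%:E : \bar R).
  exact: (measurableT_comp (measurable_EFin_indic mC) measurable_snd).
have m3 : measurable_fun setT (fun z : R * R => K z.2).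
  exact: (measurableT_comp mK measurable_snd).
rewrite (@ge0_integral_joint (fun z => (\1_B z.1)%:E * (\1_C z.2)%:E)%E); last 2 first.
- exact: emeasurable_funM.
- by move=> z; rewrite mule_ge0 ?lee_fin.
rewrite (@ge0_integral_joint (fun z => K z.2 * (\1_C z.2)%:E)%E); last 2 first.
- exact: emeasurable_funM.
- by move=> z; rewrite mule_ge0 ?lee_fin.
apply: eq_integral => v _ /=.
have mwv : measurable_fun setT (fun u : R => (w u v)%:E : \bar R).
  exact: (measurableT_comp mw (pair2_measurable v)).
transitivity ((\1_C v)%:E * \int[mu]_u ((\1_B u)%:E * (w u v)%:E))%E.
  rewrite -ge0_integralZl//.
  - by apply: eq_integral => u _; rewrite muleAC muleC.
  - by apply: (@emeasurable_funM _ R) => //; exact: measurable_EFin_indic.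
  - by move=> u _; rewrite mule_ge0 ?lee_fin.
rewrite integral_w// -/(K v) muleA [(_ * K v)%E]muleC -ge0_integralZl//.
- by move=> u _; rewrite lee_fin.
- by rewrite mule_ge0// lee_fin.
Qed.

End bayes.

(** * Moments of the truncated normal law *)

Section truncated_normal_moments.
Context {R : realType}.
Notation mu := (@lebesgue_measure R).
Variables (a s : R).
Hypothesis s0 : 0 < s.
Local Notation q := (normal_pdf a s).

Let sN0 : s != 0. Proof. by rewrite gt_eqF. Qed.

Let mom k := \int[mu]_(u in `[0, +oo[) (u ^+ k * q u).

Let iq k : mu.-integrable `[0, +oo[ (EFin \o (fun u : R => u ^+ k * q u)).
Proof.
apply: (@integrableS _ _ _ mu setT) => //; exact: integrable_exp_normal.
Qed.

(* Integrate the derivative of [- s ^+ 2 * u ^+ k * q u]. *)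
Let mom_rec k : mom k.+1 = a * mom k + s ^+ 2 * (k%:R * mom k.-1) + s ^+ 2 * (0 ^+ k * q 0).
Proof.
pose F (u : R) := - s ^+ 2 * (u ^+ k * q u).
pose f (u : R) := u ^+ k.+1 * q u - a * (u ^+ k * q u) - s ^+ 2 * k%:R * (u ^+ k.-1 * q u).
have dF (u : R) : is_derive u 1 F (f u).
  have dq := is_derive_normal_pdf a u sN0.
  have dX : is_derive u 1 (fun u : R => u ^+ k) (k%:R * u ^+ k.-1).
    have -> : (fun u : R => u ^+ k) = (@id R) ^+ k by apply/funext => v; rewrite exprfctE.
    by apply: is_derive_eq; rewrite /GRing.scale/= mulr1.
  apply: is_derive_eq; rewrite /f (exprS u k) /GRing.scale/=.
  by move: (u ^+ k) (u ^+ k.-1) => x y; field.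
have i1 : mu.-integrable `[0, +oo[ (fun u : R => a%:E * (u ^+ k * q u)%:E)%E.
  by apply: integrableZl => //; exact: iq.
have i2 : mu.-integrable `[0, +oo[
    (fun u : R => (s ^+ 2 * k%:R)%:E * (u ^+ k.-1 * q u)%:E)%E.
  by apply: integrableZl => //; exact: iq.
have cf : continuous f.
  have cX j : continuous (fun u : R => u ^+ j * q u).
    move=> u; apply: cvgM; first exact: exprn_continuous.
    exact: continuous_normal_pdf.
  move=> u; apply: cvgB; first apply: cvgB.
  - exact: cX.
  - by apply: cvgM; [exact: cvg_cst|exact: cX].
  - by apply: cvgM; [exact: cvg_cst|exact: cX].
have intf : mu.-integrable `[0, +oo[ (EFin \o f).
  rewrite (_ : EFin \o f = (fun u : R => (u ^+ k.+1 * q u)%:E - a%:E * (u ^+ k * q u)%:E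
     - (s ^+ 2 * k%:R)%:E * (u ^+ k.-1 * q u)%:E)%E)//.
  by apply: integrableB => //; apply: integrableB => //; exact: iq.
have F0 : F n%:R @[n --> \oo] --> 0.
  rewrite -[X in _ --> X](mulr0 (- s ^+ 2)); apply: cvgMr.
  exact: cvg_exp_normaly.
have := integral_itvcy_derive cf intf dF F0.
move=> /(congr1 fine) /=; rewrite -/(Rintegral mu `[0, +oo[ f) /f.
rewrite RintegralB//; last first.
  rewrite (_ : EFin \o _ = (fun u : R => (u ^+ k.+1 * q u)%:E - a%:E * (u ^+ k * q u)%:E)%E)//.
  by apply: integrableB => //; exact: iq.
rewrite [X in X - _ = _ -> _](RintegralB _ (iq k.+1) i1)//.
rewrite (RintegralZl _ _ (iq k))// (RintegralZl _ _ (iq k.-1))//.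
rewrite -/(mom k.+1) -/(mom k) -/(mom k.-1) /F => /eqP.
rewrite sub0r !subr_eq => /eqP ->; ring.
Qed.

Lemma tn_momentE k : tn_moment a (s ^+ 2) k = (mom k / std_Phi (a / s))%:E.
Proof.
rewrite /tn_moment.
have iq' := integrable_exp_normal a k s0.
transitivity ((std_Phi (a / s))^-1%:E * \int[mu]_(u in `]0%R, +oo[) (u ^+ k * q u)%:E)%E.
  rewrite -integralZl//; last by apply: (integrableS measurableT).
  rewrite [RHS]integral_indicM; apply: eq_integral => u _.
  by rewrite tn_pdfE// -!EFinM; congr EFin; ring.
rewrite integral_itv_obnd_cbnd; last first.
  by apply: measurable_funTS; have /integrableP[] := iq'.
rewrite (mulrC (mom k)) EFinM; congr (_ * _)%E.
by rewrite /mom /Rintegral fineK//; exact: (integrable_fin_num _ (iq k)).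
Qed.

Let mom0 : mom 0 = std_Phi (a / s).
Proof.
rewrite /mom /Rintegral -[RHS]/(fine (std_Phi (a / s))%:E) -(integral_normal_gt0 a s0).
rewrite integral_itv_obnd_cbnd; last first.
  by apply: measurable_funTS; exact: measurable_EFin_normal_pdf.
by congr fine; apply: eq_integral => u _; rewrite expr0 mul1r.
Qed.

(** This is [mom_rec] at [k = 0], the one case where the boundary term at 0 survives, because
    [0 ^+ 0 = 1]. It equals [s ^+ 2 * q 0], that is [s * std_phi (a / s)]. *)
Lemma tn_moment1 : tn_moment a (s ^+ 2) 1 =
  (a + s * (std_phi (a / s) / std_Phi (a / s)))%:E.
Proof.
rewrite tn_momentE mom_rec mul0r mulr0 addr0 mom0 expr0 mul1r; congr EFin.
have -> : std_phi (a / s) = s * q 0.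
  rewrite /std_phi -(normal_pdfN _ (oner_neq0 R)) -(normal_pdf_scale a _ s0).
  by congr (_ * normal_pdf _ _ _); field.
by have := std_Phi_gt0 (a / s); move: (std_Phi _) => Q Q0; field; rewrite gt_eqF.
Qed.

Lemma tn_moment_rec k : tn_moment a (s ^+ 2) k.+2 =
  (a%:E * tn_moment a (s ^+ 2) k.+1 + (k.+1%:R * s ^+ 2)%:E * tn_moment a (s ^+ 2) k)%E.
Proof.
rewrite !tn_momentE -!EFinM -EFinD; congr EFin; rewrite mom_rec expr0n mul0r mulr0 addr0/=.
by ring.
Qed.

End truncated_normal_moments.

(** * Column vectors, scalar products and boxes *)

Section column_vectors.
Context {R : realType} {p : nat}.
Implicit Types (a b z : 'cV[R]_p) (M : 'M[R]_p).

Definition dot a z : R := sc (a^T *m z).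

(** Coordinates are indexed by [nat], with default 0, so that vectors fit the inductions over the
    number of coordinates. *)
Definition coord z (i : nat) : R := if insub i is Some j then z j ord0 else 0.

Lemma coord_ord z (j : 'I_p) : coord z j = z j ord0.
Proof. by rewrite /coord valK. Qed.

Lemma dotE a z : dot a z = \sum_(i < p) coord a i * coord z i.
Proof.
by rewrite /dot /sc mxE; apply: eq_bigr => i _; rewrite mxE !coord_ord.
Qed.

Lemma dotC a z : dot a z = dot z a.
Proof. by rewrite !dotE; apply: eq_bigr => i _; rewrite mulrC. Qed.

Lemma dotDl a b z : dot (a + b) z = dot a z + dot b z.
Proof. by rewrite /dot /sc linearD mulmxDl mxE. Qed.

Lemma dot0l z : dot 0 z = 0.
Proof. by rewrite /dot /sc trmx0 mul0mx mxE. Qed.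

Lemma dotZl (c : R) a z : dot (c *: a) z = c * dot a z.
Proof. by rewrite /dot /sc linearZ -scalemxAl mxE. Qed.

Lemma dotDr a b z : dot z (a + b) = dot z a + dot z b.
Proof. by rewrite !(dotC z) dotDl. Qed.

Lemma dotZr (c : R) a z : dot z (c *: a) = c * dot z a.
Proof. by rewrite !(dotC z) dotZl. Qed.

Lemma dot_mulmx M a z : dot a (M *m z) = dot (M^T *m a) z.
Proof. by rewrite /dot trmx_mul trmxK mulmxA. Qed.

Lemma col_of_coord (al : nat -> R) (i : nat) : (i < p)%N ->
  coord (\col_j al (val j)) i = al i.
Proof. by move=> ip; rewrite -[i]/(val (Ordinal ip)) coord_ord mxE. Qed.

Lemma prod_indic_coord (C : nat -> set R) z :
  \prod_(i < p) \1_(C i) (coord z i) = \1_(rect (fun i : 'I_p => C i)) z :> R.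
Proof.
rewrite [RHS]indicE; case: (pselect (rect (fun i : 'I_p => C i) z)) => [rz|nrz].
  rewrite mem_set// big1// => i _; rewrite coord_ord indicE mem_set//.
rewrite memNset//.
have [i nCi] : exists i : 'I_p, ~ C i (z i ord0) by exact/existsNP.
by rewrite (bigD1 i)//= coord_ord indicE memNset// mul0r.
Qed.

End column_vectors.

(** * The conditional law of the exponential variable given the whole vector *)

Section exponential_gaussian_mixture.
Context d (T : measurableType d) (R : realType) (P : probability T R) (p : nat).
Local Notation bm := bounded_measurable.
Local Notation Ex := (Rintegral P setT).
Variables (G : 'M[R]_p) (de b : 'cV[R]_p) (eta : R) (U : T -> R) (Z : T -> 'cV[R]_p).
Hypotheses (Gsym : G^T = G) (Gpos : forall a : 'cV[R]_p, a != 0 -> 0 < dot a (G *m a)).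
Hypotheses (eta0 : 0 < eta) (Gb : G *m b = de) (bde : dot b de = eta ^+ 2).
Hypothesis mU : measurable_fun setT U.
Hypothesis mZ : forall i : 'I_p, measurable_fun setT (fun t => Z t i ord0).
Hypothesis lawU : forall B : set R, measurable B -> P (U @^-1` B) = exponential_prob 1 B.
Hypothesis lawZ : forall a : 'cV[R]_p, a != 0 -> forall B : set R, measurable B ->
  P ((fun t => dot a (Z t)) @^-1` B) = normal_prob 0 (Num.sqrt (dot a (G *m a))) B.
Hypothesis indUZ : forall (B : set R) (C : 'I_p -> set R), measurable B ->
  (forall i, measurable (C i)) ->
  P (U @^-1` B `&` Z @^-1` rect C) = (P (U @^-1` B) * P (Z @^-1` rect C))%E.

Let qf a := dot a (G *m a).
Let W t := U t *: de + Z t.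

Let mcoord i : measurable_fun setT (fun t => coord (Z t) i).
Proof. by rewrite /coord; case: insubP => [j _ _|_]; [exact: mZ|exact: measurable_cst]. Qed.

Let mdotZ a : measurable_fun setT (fun t => dot a (Z t)).
Proof.
rewrite (_ : (fun t => _) = fun t => \sum_(i < p) coord a i * coord (Z t) i); last first.
  by apply/funext => t; rewrite dotE.
by apply: measurable_sum => i; exact: measurable_funM.
Qed.

Let dotW a t : dot a (W t) = dot a de * U t + dot a (Z t).
Proof. by rewrite /W dotDr dotZr mulrC. Qed.

Let mdotW a : measurable_fun setT (fun t => dot a (W t)).
Proof.
rewrite (_ : (fun t => _) = fun t => dot a de * U t + dot a (Z t)); last first.
  by apply/funext => t; rewrite dotW.
by apply: measurable_funD => //; exact: measurable_funM.
Qed.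

Lemma Rintegral_indic_preimage (X : T -> R) (B : set R) : measurable_fun setT X -> measurable B ->
  Ex (fun t => \1_B (X t)) = fine (P (X @^-1` B)).
Proof.
move=> mX mB; congr fine.
rewrite (_ : (fun t => _) = (fun t => (\1_(X @^-1` B) t)%:E)) ?integral_indic ?setIT//.
by rewrite -[X in measurable X]setTI; exact: mX.
Qed.

Let mRect (C : nat -> set R) : (forall i, measurable (C i)) ->
  measurable (Z @^-1` rect (fun i : 'I_p => C i)).
Proof.
move=> mC; rewrite (_ : _ @^-1` _ = \bigcap_(i : 'I_p) ((fun t => Z t i ord0) @^-1` C i)).
  apply: fin_bigcap_measurable => // i _.
  by rewrite -[X in measurable X]setTI; exact: mZ.
by apply/seteqP; split => t /= h i; [move=> _|]; exact: h.
Qed.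

(** Independence says that the centred indicator of [U] in [B] is orthogonal to all boxes in [Z];
    [cos0_of_rect0] turns boxes into cosines. *)
Let cosZ_indep (B : set R) a th : measurable B ->
  Ex (fun t => (\1_B (U t) - fine (P (U @^-1` B))) * cos (dot a (Z t) + th)) = 0.
Proof.
move=> mB; pose k := fine (P (U @^-1` B)).
have bB := bm_indic mU mB.
transitivity (Ex (fun t => (\1_B (U t) - k) *
    cos (\sum_(i < p) coord a i * coord (Z t) i + th))).
  by apply: eq_Rintegral => t _; rewrite dotE.
apply: (cos0_of_rect0 (X := fun i t => coord (Z t) i)) => //.
  by apply: bmB => //; exact: bm_cst.
move=> C mC; have mR := mRect mC.
have mUB : measurable (U @^-1` B) by rewrite -[X in measurable X]setTI; exact: mU.
pose rZ := Z @^-1` rect (fun i : 'I_p => C i).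
have brZ : bm (\1_rZ : T -> R).
  by split; [exact: measurable_indic|exists 1 => t; exact: indic_norm_le1].
transitivity (Ex (fun t => \1_(U @^-1` B `&` rZ) t - k * \1_rZ t)).
  apply: eq_Rintegral => t _; rewrite prod_indic_coord mulrBl; congr (_ - _ * _).
  by rewrite indicI.
have E1 (A : set T) : measurable A -> Ex (\1_A : T -> R) = fine (P A).
  by move=> mA; congr fine; rewrite integral_indic ?setIT.
rewrite bmRintegralB; [|split; [exact: measurable_indic (measurableI _ _ mUB mR)|
  by exists 1 => t; exact: indic_norm_le1]|exact: bmZ].
rewrite bmRintegralZ// !E1//; last exact: measurableI.
by rewrite indUZ// fineM ?subrr// fin_num_measure.
Qed.

Let Ex_cosZ a th : Ex (fun t => cos (dot a (Z t) + th)) = cos th * expR (- qf a / 2).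
Proof.
(* The law of [a . Z] is prescribed for nonzero [a] only; at 0 the cosine is constant. *)
have [->|a0] := eqVneq a 0.
  under eq_Rintegral do rewrite dot0l add0r.
  by rewrite Rintegral_prob_cst /qf dot0l oppr0 mul0r expR0 mulr1.
have s0 : 0 < Num.sqrt (qf a) by rewrite sqrtr_gt0 Gpos.
have mc : measurable_fun setT (fun x : R => cos (1 * x + th)).
  apply: measurableT_comp; first by apply: continuous_measurable_fun; exact: continuous_cos.
  by apply: measurable_funD => //; exact: measurable_funM.
transitivity (Ex (fun t => cos (1 * dot a (Z t) + th))).
  by apply: eq_Rintegral => t _; rewrite mul1r.
rewrite (Rintegral_density (f := fun x => cos (1 * x + th)) (q := normal_pdf 0 (Num.sqrt (qf a)))
  (M := 1) (mdotZ a)) //; last 4 first.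
- exact: measurable_normal_pdf.
- exact: normal_pdf_ge0.
- by move=> A mA; exact: lawZ.
- by move=> x; exact: cos_norm_le1.
by rewrite gaussian_charfun// mulr1 sqr_sqrtr// ltW// Gpos.
Qed.

(** The roles are exchanged: the centred cosine now plays [H], and indicators of [U] are replaced by
    bounded functions of [U]. *)
Let Ex_fU_cosZ (f : R -> R) (M : R) a th : measurable_fun setT f -> (forall x, `|f x| <= M) ->
  Ex (fun t => f (U t) * cos (dot a (Z t) + th)) =
  Ex (fun t => f (U t)) * (cos th * expR (- qf a / 2)).
Proof.
move=> mf fM.
have bc : bm (fun t => cos (dot a (Z t) + th)) by apply: bm_cos; exact: measurable_funD.
have bf : bm (fun t => f (U t)) by split; [exact: measurableT_comp|exists M].
pose k := cos th * expR (- qf a / 2).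
have bck : bm (fun t => cos (dot a (Z t) + th) - k) by apply: bmB => //; exact: bm_cst.
have := @indic0_bounded _ _ _ P (fun t => cos (dot a (Z t) + th) - k) U f M bck mU _ mf fM.
rewrite (_ : (fun t => _) = fun t => f (U t) * cos (dot a (Z t) + th) - k * f (U t)); last first.
  by apply/funext => t; ring.
rewrite bmRintegralB; [|exact: bmM|exact: bmZ].
rewrite bmRintegralZ// [k * _]mulrC => h; apply/eqP; rewrite -subr_eq0; apply/eqP; apply: h.
move=> B mB; have bB := bm_indic mU mB.
have := cosZ_indep a th mB.
rewrite (_ : (fun t => _) = fun t => \1_B (U t) * cos (dot a (Z t) + th) -
  fine (P (U @^-1` B)) * cos (dot a (Z t) + th)); last by apply/funext => t; ring.
rewrite bmRintegralB; [|exact: bmM|exact: bmZ].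
rewrite bmRintegralZ// Ex_cosZ -/k => h.
rewrite (_ : (fun t => _) = fun t => \1_B (U t) * cos (dot a (Z t) + th) - k * \1_B (U t));
  last by apply/funext => t; ring.
rewrite bmRintegralB; [|exact: bmM|exact: bmZ].
by rewrite bmRintegralZ// Rintegral_indic_preimage// [k * _]mulrC.
Qed.

(** The addition formula separates [(a . de) U + th] from [a . Z]. The sine term drops out because
    [a . Z] is symmetric, which appears here as [cos (- (pi / 2)) = 0]. *)
Let Ex_fU_cosW (f : R -> R) (M : R) a th : measurable_fun setT f -> (forall x, `|f x| <= M) ->
  Ex (fun t => f (U t) * cos (dot a (W t) + th)) =
  Ex (fun t => f (U t) * cos (dot a de * U t + th)) * expR (- qf a / 2).
Proof.
move=> mf fM; pose c := dot a de.
have M0 : 0 <= M by exact: le_trans (fM 0).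
have mcU : measurable_fun setT (fun x : R => c * x + th).
  by apply: measurable_funD => //; exact: measurable_funM.
have mc : measurable_fun setT (fun x : R => f x * cos (c * x + th)).
  apply: measurable_funM => //; apply: measurableT_comp mcU.
  by apply: continuous_measurable_fun; exact: continuous_cos.
have ms : measurable_fun setT (fun x : R => f x * sin (c * x + th)).
  apply: measurable_funM => //; apply: measurableT_comp mcU.
  by apply: continuous_measurable_fun; exact: continuous_sin.
have hc x : `|f x * cos (c * x + th)| <= M.
  by rewrite normrM -[leRHS]mulr1 ler_pM// cos_norm_le1.
have hs x : `|f x * sin (c * x + th)| <= M.
  by rewrite normrM -[leRHS]mulr1 ler_pM// sin_norm_le1.
have bcz th' : bm (fun t => cos (dot a (Z t) + th')) by apply: bm_cos; exact: measurable_funD.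
have bcU : bm (fun t => f (U t) * cos (c * U t + th)).
  by split; [exact: (measurableT_comp mc mU)|exists M => t; exact: hc].
have bsU : bm (fun t => f (U t) * sin (c * U t + th)).
  by split; [exact: (measurableT_comp ms mU)|exists M => t; exact: hs].
transitivity (Ex (fun t => f (U t) * cos (c * U t + th) * cos (dot a (Z t) + 0) -
   f (U t) * sin (c * U t + th) * cos (dot a (Z t) + - (pi / 2)))).
  apply: eq_Rintegral => t _; rewrite cosBpihalf addr0 dotW -/c.
  have -> : c * U t + dot a (Z t) + th = c * U t + th + dot a (Z t) by ring.
  by rewrite cosD; ring.
rewrite bmRintegralB; [|exact: bmM|exact: bmM].
rewrite (Ex_fU_cosZ a 0 mc hc) (Ex_fU_cosZ a (- (pi / 2)) ms hs).
by rewrite cos0 cosN cos_pihalf mul1r mul0r mulr0 subr0.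
Qed.

Let S t := dot b (W t).
Let loc v := eta^-1 * (eta^-1 * (v - 1)).
Let K (B : set R) v := fine (tn_prob (loc v) (eta^-1 ^+ 2) B).

Let SE t : S t = eta ^+ 2 * U t + dot b (Z t).
Proof. by rewrite /S dotW bde. Qed.

Let qfb : qf b = eta ^+ 2. Proof. by rewrite /qf Gb. Qed.

Let b_neq0 : b != 0.
Proof.
apply/eqP => b0; have := bde; rewrite b0 dot0l => /esym/eqP.
by rewrite sqrf_eq0 gt_eqF.
Qed.

Let qfD a (s : R) : qf (a + s *: b) = qf a + 2 * s * dot a de + s ^+ 2 * eta ^+ 2.
Proof.
rewrite /qf linearD linearZ/= Gb !(dotDl, dotDr, dotZl, dotZr) bde.
have -> : dot b (G *m a) = dot a de by rewrite dot_mulmx Gsym Gb dotC.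
by ring.
Qed.

Let qfZ (s : R) : qf (s *: b) = s ^+ 2 * eta ^+ 2.
Proof. by rewrite /qf linearZ/= Gb dotZl dotZr bde; ring. Qed.

(** Independence is given for boxes in the coordinates of [Z], whereas Bayes' formula needs it for
    the linear form [b . Z]. The cosines of multiples of [b . Z] bridge the gap by Fourier
    uniqueness. *)
Let indep_UX (A B : set R) : measurable A -> measurable B ->
  P (U @^-1` A `&` (fun t => dot b (Z t)) @^-1` B) =
  (P (U @^-1` A) * P ((fun t => dot b (Z t)) @^-1` B))%E.
Proof.
move=> mA mB; pose X t := dot b (Z t); pose k := fine (P (U @^-1` A)).
have bA := bm_indic mU mA; have bB := bm_indic (mdotZ b) mB.
have bH : bm (fun t => \1_A (U t) - k) by apply: bmB => //; exact: bm_cst.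
have := @fourier_indic0 _ _ _ P (fun t => \1_A (U t) - k) X bH (mdotZ b) _ _ B mB.
have mUA : measurable (U @^-1` A) by rewrite -[X in measurable X]setTI; exact: mU.
have mXB : measurable (X @^-1` B) by rewrite -[X in measurable X]setTI; exact: mdotZ.
rewrite (_ : (fun t => _) = fun t => \1_A (U t) * \1_B (X t) - k * \1_B (X t)); last first.
  by apply/funext => t; rewrite mulrBl.
rewrite bmRintegralB; [|exact: bmM|exact: bmZ].
rewrite bmRintegralZ// Rintegral_indic_preimage//; last exact: mdotZ.
have -> : Ex (fun t => \1_A (U t) * \1_B (X t)) = fine (P (U @^-1` A `&` X @^-1` B)).
  congr fine; rewrite (_ : (fun t => _) = fun t => (\1_(U @^-1` A `&` X @^-1` B) t)%:E).
    by rewrite integral_indic ?setIT//; exact: measurableI.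
  by apply/funext => t; rewrite indicI.
have fk := fin_num_measure P _ mUA; have fX := fin_num_measure P _ mXB.
have fUX := fin_num_measure P _ (measurableI _ _ mUA mXB).
rewrite /k -fineM// => h.
have {h} : fine (P (U @^-1` A `&` X @^-1` B)) = fine (P (U @^-1` A) * P (X @^-1` B))%E.
  apply/eqP; rewrite -subr_eq0; apply/eqP; apply: h.
  - move=> s; rewrite -[RHS](cosZ_indep (s *: b) 0 mA); apply: eq_Rintegral => t _.
    by rewrite addr0 dotZl.
  - move=> s; rewrite -[RHS](cosZ_indep (s *: b) (- (pi / 2)) mA); apply: eq_Rintegral => t _.
    by rewrite cosBpihalf dotZl.
by move=> h; rewrite -[LHS]fineK// -[RHS]fineK ?fin_numM// h.
Qed.

Let mS : measurable_fun setT S. Proof. exact: mdotW. Qed.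

Let mK (B : set R) : measurable B -> measurable_fun setT (K B).
Proof.
move=> mB; apply: measurableT_comp => //.
apply: (measurableT_comp (measurable_tn_prob _ mB)); first by rewrite invr_gt0.
by apply: measurable_funM => //; apply: measurable_funM => //; exact: measurable_funB.
Qed.

Let K_le1 (B : set R) v : measurable B -> `|K B v| <= 1.
Proof.
move=> mB; have eta'0 : 0 < eta^-1 by rewrite invr_gt0.
rewrite /K ger0_norm ?fine_ge0 ?tn_prob_ge0// -lee_fin fineK ?tn_prob_le1//.
exact: tn_prob_fin_num.
Qed.

Let bayes_cos (B : set R) (s th : R) : measurable B ->
  Ex (fun t => (\1_B (U t) - K B (S t)) * cos (s * S t + th)) = 0.
Proof.
move=> mB.
have bKS : bm (fun t => K B (S t)).
  by split; [exact: (measurableT_comp (mK mB) mS)|exists 1 => t; exact: K_le1].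
have bH : bm (fun t => \1_B (U t) - K B (S t)) by apply: bmB => //; exact: bm_indic.
have mc : measurable_fun setT (fun x : R => cos (s * x + th)).
  apply: measurableT_comp; first by apply: continuous_measurable_fun; exact: continuous_cos.
  by apply: measurable_funD => //; exact: measurable_funM.
apply: (indic0_bounded bH mS _ mc (fun x => cos_norm_le1 _)) => C mC.
have lawX (A : set R) : measurable A -> P ((fun t => dot b (Z t)) @^-1` A) = normal_prob 0 eta A.
  move=> mA; rewrite lawZ// -/(qf b) qfb sqrtr_sqr gtr0_norm//.
have := bayes_exponential_normal mU (mdotZ b) eta0 indep_UX lawU lawX mB mC.
by move=> h; rewrite -[RHS]h; apply: eq_Rintegral => t _; rewrite SE.
Qed.

(* Given [S], the law of [W] does not involve [U]: [S] is sufficient. *)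
Let sufficiency (f : R -> R) (a : 'cV[R]_p) (th : R) : measurable_fun setT f ->
  (forall x, `|f x| <= 1) ->
  let s := dot a de / eta ^+ 2 in
  Ex (fun t => f (S t) * cos (dot a (W t) + th)) =
  expR (- (qf a - s ^+ 2 * eta ^+ 2) / 2) * Ex (fun t => f (S t) * cos (s * S t + th)).
Proof.
move=> mf f1 s; pose k := expR (- (qf a - s ^+ 2 * eta ^+ 2) / 2).
have etaN0 : eta != 0 by rewrite gt_eqF.
have sE : dot a de = s * eta ^+ 2 by rewrite /s divfK// sqrf_eq0.
have bcW c ph : bm (fun t => cos (dot c (W t) + ph)) by apply: bm_cos; exact: measurable_funD.
have bcS r ph : bm (fun t => cos (r * S t + ph)).
  by apply: bm_cos; apply: measurable_funD => //; exact: measurable_funM.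
have bf : bm (fun t => f (S t)) by split; [exact: measurableT_comp|exists 1].
have m1 : measurable_fun setT (fun _ : R => 1 : R) by exact: measurable_cst.
have n1 (x : R) : `|1 : R| <= 1 by rewrite normr1.
have shift r ph : Ex (fun t => cos (dot (a + r *: b) (W t) + ph)) =
    k * Ex (fun t => cos (dot ((s + r) *: b) (W t) + ph)).
  have E1 c : Ex (fun t => cos (dot c (W t) + ph)) =
      Ex (fun t => cos (dot c de * U t + ph)) * expR (- qf c / 2).
    have := Ex_fU_cosW c ph m1 n1.
    by under eq_Rintegral do rewrite mul1r; under [in X in _ = X -> _]eq_Rintegral do rewrite mul1r.
  rewrite !E1 qfD qfZ [RHS]mulrCA /k -expRD dotDl !dotZl bde sE.
  congr (_ * expR _); last by field.
  by apply: eq_Rintegral => t _; congr cos; ring.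
pose H t := cos (dot a (W t) + th) - k * cos (s * S t + th).
have bH : bm H by apply: bmB => //; exact: bmZ.
have HS r ph : Ex (fun t => H t * cos (r * S t + ph)) = 0.
  transitivity (Ex (fun t =>
     2^-1 * (cos (dot (a + r *: b) (W t) + (th + ph)) -
             k * cos (dot ((s + r) *: b) (W t) + (th + ph))) +
     2^-1 * (cos (dot (a + (- r) *: b) (W t) + (th - ph)) -
             k * cos (dot ((s + - r) *: b) (W t) + (th - ph))))).
    apply: eq_Rintegral => t _; rewrite /H !dotDl !dotZl -/(S t).
    have -> : dot a (W t) + r * S t + (th + ph) = dot a (W t) + th + (r * S t + ph) by ring.
    have -> : dot a (W t) + - r * S t + (th - ph) = dot a (W t) + th - (r * S t + ph) by ring.
    have -> : (s + r) * S t + (th + ph) = s * S t + th + (r * S t + ph) by ring.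
    have -> : (s + - r) * S t + (th - ph) = s * S t + th - (r * S t + ph) by ring.
    rewrite (cosD (dot a _ + th)) (cosB (dot a _ + th)) (cosD (s * _ + th)) (cosB (s * _ + th)).
    by field.
  have bD r' ph' : bm (fun t => cos (dot (a + r' *: b) (W t) + ph') -
             k * cos (dot ((s + r') *: b) (W t) + ph')) by apply: bmB => //; exact: bmZ.
  rewrite bmRintegralD; [|exact: bmZ|exact: bmZ].
  rewrite !bmRintegralZ// !bmRintegralB//; [|exact: bmZ|exact: bmZ].
  by rewrite !bmRintegralZ// !shift !subrr mulr0 addr0.
have HC (C : set R) : measurable C -> Ex (fun t => H t * \1_C (S t)) = 0.
  apply: fourier_indic0 => //.
  - by move=> r; rewrite -[RHS](HS r 0); apply: eq_Rintegral => t _; rewrite addr0.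
  - by move=> r; rewrite -[RHS](HS r (- (pi / 2))); apply: eq_Rintegral => t _; rewrite cosBpihalf.
have := indic0_bounded bH mS HC mf f1.
rewrite (_ : (fun t => _) = fun t => f (S t) * cos (dot a (W t) + th) -
    k * (f (S t) * cos (s * S t + th))); last by apply/funext => t; rewrite /H; ring.
rewrite bmRintegralB; [|exact: bmM|by apply: bmZ; exact: bmM].
rewrite bmRintegralZ; last exact: bmM.
by move=> /eqP; rewrite subr_eq0 => /eqP.
Qed.

(** In the kernel term, [sufficiency] replaces [a . W] by [s S], and [bayes_cos] replaces the kernel
    by [\1_B (U t)]. What remains compares [a] with [s *: b] in [Ex_fU_cosW]: both have scalar
    product [s * eta ^+ 2] with [de], and the exponents [qf a - s^2 eta^2] and [s^2 eta^2] add up to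
    [qf a]. *)
Lemma cond_law_cos (B : set R) a th : measurable B ->
  Ex (fun t => (\1_B (U t) - K B (S t)) * cos (dot a (W t) + th)) = 0.
Proof.
move=> mB; pose s := dot a de / eta ^+ 2.
have etaN0 : eta != 0 by rewrite gt_eqF.
have bB := bm_indic mU mB.
have bKS : bm (fun t => K B (S t)).
  by split; [exact: (measurableT_comp (mK mB) mS)|exists 1 => t; exact: K_le1].
have bcW c ph : bm (fun t => cos (dot c (W t) + ph)) by apply: bm_cos; exact: measurable_funD.
have bcS r ph : bm (fun t => cos (r * S t + ph)).
  by apply: bm_cos; apply: measurable_funD => //; exact: measurable_funM.
have m1 : measurable_fun setT (\1_B : R -> R) by exact: measurable_indic.
have n1 (x : R) : `|\1_B x : R| <= 1 by exact: indic_norm_le1.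
rewrite (_ : (fun t => _) = fun t => \1_B (U t) * cos (dot a (W t) + th) -
    K B (S t) * cos (dot a (W t) + th)); last by apply/funext => t; rewrite mulrBl.
rewrite bmRintegralB; [|exact: bmM|exact: bmM].
rewrite (sufficiency a th (mK mB) (fun v => K_le1 v mB)) -/s.
have -> : Ex (fun t => K B (S t) * cos (s * S t + th)) =
    Ex (fun t => \1_B (U t) * cos (dot (s *: b) (W t) + th)).
  have := bayes_cos s th mB.
  rewrite (_ : (fun t => _) = fun t => \1_B (U t) * cos (s * S t + th) -
    K B (S t) * cos (s * S t + th)); last by apply/funext => t; rewrite mulrBl.
  rewrite bmRintegralB; [|exact: bmM|exact: bmM].
  move=> /eqP; rewrite subr_eq0 => /eqP <-.
  by apply: eq_Rintegral => t _; rewrite dotZl.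
rewrite (Ex_fU_cosW a th m1 n1) (Ex_fU_cosW (s *: b) th m1 n1) qfZ.
rewrite mulrCA -expRD dotZl bde.
have -> : s * eta ^+ 2 = dot a de by rewrite /s divfK// sqrf_eq0.
apply/eqP; rewrite subr_eq0; apply/eqP; congr (_ * expR _); by field.
Qed.

End exponential_gaussian_mixture.

(** * Removing the scale matrix from the parameters *)

Section scale_matrices.
Context {R : realType} {p : nat}.
Implicit Types (M Om : 'M[R]_p) (de : 'cV[R]_p).

Lemma spd_unitmx M : spd M -> M \in unitmx.
Proof.
move=> [_ Mpos]; rewrite unitmxE unitfE; apply/negP => /det0P[v v0 vM].
have := Mpos v^T; rewrite trmxK vM mul0mx /sc mxE ltxx => /(_ _)/negP; apply=> //.
by apply: contraNneq v0 => /(congr1 trmx); rewrite trmxK trmx0 => ->.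
Qed.

Lemma spd_diag_gt0 M i : spd M -> 0 < M i i.
Proof.
move=> [_ Mpos]; have := Mpos (delta_mx i ord0).
rewrite trmx_delta -rowE -colE /sc !mxE; apply.
by apply/eqP => /matrixP/(_ i ord0); rewrite !mxE !eqxx => /eqP; rewrite oner_eq0.
Qed.

Lemma omega_of_sym Om : (omega_of Om)^T = omega_of Om.
Proof.
by apply/matrixP => i j; rewrite !mxE eq_sym; case: eqVneq => // ->.
Qed.

Lemma omega_of_unit Om : spd Om -> omega_of Om \in unitmx.
Proof.
move=> spdO.
have h : omega_of Om *m diag_mx (\row_j (Num.sqrt (Om j j))^-1) = 1%:M.
  rewrite mul_mx_diag; apply/matrixP => i j; rewrite !mxE.
  case: eqVneq => [<-|]; last by rewrite mul0r.
  by rewrite divff// gt_eqF// sqrtr_gt0 spd_diag_gt0.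
by have [] := mulmx1_unit h.
Qed.

Lemma SigmaYE Om de : spd Om ->
  SigmaY Om de = omega_of Om *m (Ombar Om - de *m de^T) *m omega_of Om.
Proof.
move=> /omega_of_unit uo; rewrite /SigmaY mulmxBr mulmxBl /Ombar !mulmxA.
by rewrite mulmxV// mul1mx mulmxKV.
Qed.

(** This turns [de^T om SigmaY^-1] into [b^T om^-1], so that [eta] and [A] depend on the
    standardised vector alone. *)
Lemma invmx_SigmaY Om de : spd Om -> spd (Ombar Om - de *m de^T) ->
  invmx (SigmaY Om de) =
  invmx (omega_of Om) *m invmx (Ombar Om - de *m de^T) *m invmx (omega_of Om).
Proof.
move=> spdO spdG; have uo := omega_of_unit spdO; have uG := spd_unitmx spdG.
rewrite SigmaYE//; set G := Ombar Om - _ in uG *; set w := omega_of Om in uo *.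
have h : w *m G *m w *m (invmx w *m invmx G *m invmx w) = 1%:M.
  by rewrite !mulmxA mulmxK// mulmxK// mulmxV.
have [uS _] := mulmx1_unit h.
by rewrite -[LHS]mulmx1 -h mulKmx.
Qed.

Lemma invmx_sym M : M^T = M -> (invmx M)^T = invmx M.
Proof. by move=> sM; rewrite trmx_inv sM. Qed.

End scale_matrices.

(** * The conditional law and its moments in the original coordinates *)

Theorem theorem8 (R : realType) (d : measure_display) (T : measurableType d)
  (P : probability T R) (p : nat)
  (xi : 'cV[R]_p) (Om : 'M[R]_p) (de : 'cV[R]_p)
  (U : T -> R) (Z : T -> 'cV[R]_p) :
  spd Om ->
  spd (Ombar Om - de *m de^T) ->
  de != 0 ->
  (* U is standard exponential *)
  measurable_fun [set: T] U ->
  (forall B : set R, measurable B -> P (U @^-1` B) = exponential_prob 1 B) ->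
  (* Z ~ N_p(0, Ombar - de de^T), stated via one-dimensional projections *)
  (forall i : 'I_p, measurable_fun [set: T] (fun t => Z t i ord0)) ->
  (forall a : 'cV[R]_p, a != 0 -> forall B : set R, measurable B ->
     P ((fun t => sc (a^T *m Z t)) @^-1` B) =
     normal_prob 0 (Num.sqrt (sc (a^T *m (Ombar Om - de *m de^T) *m a))) B) ->
  (* U and Z are independent *)
  (forall (B : set R) (C : 'I_p -> set R), measurable B ->
     (forall i, measurable (C i)) ->
     P (U @^-1` B `&` Z @^-1` rect C) = (P (U @^-1` B) * P (Z @^-1` rect C))%E) ->
  let Y := fun t => xi + omega_of Om *m (U t *: de + Z t) in
  let eta := eta_of Om de in
  (* the conditional law of U given Y = y is TN(eta^{-1} A(y), eta^{-2}, (0,oo)) *)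
  (forall (B : set R) (C : 'I_p -> set R), measurable B ->
     (forall i, measurable (C i)) ->
     P (U @^-1` B `&` Y @^-1` rect C) =
     (\int[P]_(t in Y @^-1` rect C) cond_kernel xi Om de (Y t) B)%E) /\
  (forall y : 'cV[R]_p,
     let A := A_of xi Om de y in
     cond_moment xi Om de 1 y = (eta^-1 * (A + std_phi A / std_Phi A))%:E /\
     (forall k : nat, (2 <= k)%N ->
        cond_moment xi Om de k y =
        ((A * eta^-1)%:E * cond_moment xi Om de k.-1 y +
         ((k.-1)%:R * eta ^- 2)%:E * cond_moment xi Om de k.-2 y)%E)).
Proof.
move=> spdO spdG de0 mU lawU mZ lawZ indUZ Y eta.
have uo := omega_of_unit spdO; have uG := spd_unitmx spdG.
have iS := invmx_SigmaY spdO spdG.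
set G := Ombar Om - de *m de^T in spdG lawZ uG iS.
set om := omega_of Om in uo iS Y *.
have [Gsym Gpos] := spdG.
pose b := invmx G *m de.
have Gb : G *m b = de by rewrite /b mulKVmx.
have bT : b^T = de^T *m invmx G by rewrite /b trmx_mul invmx_sym.
have b0 : b != 0 by apply: contraNneq de0 => b0; rewrite -Gb b0 mulmx0.
have Gpos' (a : 'cV[R]_p) : a != 0 -> 0 < dot a (G *m a).
  by move=> /Gpos; rewrite /dot mulmxA.
have bde0 : 0 < dot b de by rewrite -Gb; exact: Gpos'.
have etaE : eta = Num.sqrt (dot b de).
  rewrite /eta /eta_of iS /dot bT -/om; congr (Num.sqrt (sc _)).
  by rewrite !mulmxA mulmxK// mulmxKV.
have eta0 : 0 < eta by rewrite etaE sqrtr_gt0.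
have bde : dot b de = eta ^+ 2 by rewrite etaE sqr_sqrtr// ltW.
have AE y : A_of xi Om de y = eta^-1 * (dot b (invmx om *m (y - xi)) - 1).
  rewrite /A_of iS -/eta -/om /dot bT; congr (_ * (sc _ - 1)).
  by rewrite !mulmxA mulmxK.
have etaV : eta ^- 2 = eta^-1 ^+ 2 by rewrite exprVn.
(* The moments concern the kernel alone: with standard deviation [eta^-1] and location [eta^-1 * A],
   their ratio is [A]. *)
split; last first.
  move=> y A; have eta'0 : 0 < eta^-1 by rewrite invr_gt0.
  have aA : eta^-1 * A / eta^-1 = A by rewrite mulrAC mulfV ?mul1r// gt_eqF.
  rewrite /cond_moment -/A -/eta etaV; split.
    by rewrite tn_moment1// aA mulrDr.
  by case=> [|[|k]]// _; rewrite tn_moment_rec// (mulrC A).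
move=> B C mB mC.
pose W t := U t *: de + Z t.
have lawZ' (a : 'cV[R]_p) : a != 0 -> forall B : set R, measurable B ->
    P ((fun t => dot a (Z t)) @^-1` B) = normal_prob 0 (Num.sqrt (dot a (G *m a))) B.
  by move=> a0 B' mB'; rewrite /dot mulmxA; exact: lawZ.
pose K t := fine (tn_prob (eta^-1 * (eta^-1 * (dot b (W t) - 1))) (eta^-1 ^+ 2) B).
have eta'0 : 0 < eta^-1 by rewrite invr_gt0.
have YW t : invmx om *m (Y t - xi) = W t by rewrite /Y addrC addKr mulKmx.
have kernelE t : cond_kernel xi Om de (Y t) B = (K t)%:E.
  rewrite /K fineK; last exact: tn_prob_fin_num.
  by rewrite /cond_kernel AE YW -/eta etaV.
have mW j : measurable_fun setT (fun t => W t j ord0).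
  rewrite (_ : (fun t => _) = fun t => U t * de j ord0 + Z t j ord0); last first.
    by apply/funext => t; rewrite !mxE.
  by apply: measurable_funD => //; exact: measurable_funM.
have mY i : measurable_fun setT (fun t => coord (Y t) i).
  rewrite /coord; case: insubP => [j _ _|_]; last exact: measurable_cst.
  rewrite (_ : (fun t => _) = fun t => xi j ord0 + \sum_k om j k * W t k ord0); last first.
    by apply/funext => t; rewrite mxE; congr (_ + _); rewrite mxE.
  apply: measurable_funD => //; apply: measurable_sum => k.
  exact: measurable_funM.
have mdotW : measurable_fun setT (fun t => dot b (W t)).
  rewrite (_ : (fun t => _) = fun t => \sum_(k < p) coord b k * W t k ord0); last first.
    by apply/funext => t; rewrite dotE; apply: eq_bigr => k _; rewrite (coord_ord (W t)).
  by apply: measurable_sum => k; exact: measurable_funM.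
have bK : bounded_measurable K.
  split.
    apply: measurableT_comp => //.
    apply: (measurableT_comp (measurable_tn_prob eta'0 mB)).
    by apply: measurable_funM => //; apply: measurable_funM => //; exact: measurable_funB.
  exists 1 => t; rewrite /K ger0_norm ?fine_ge0 ?tn_prob_ge0// -lee_fin fineK ?tn_prob_le1//.
  exact: tn_prob_fin_num.
have bB := bm_indic mU mB.
(* The box is extended to all of [nat] by the full line, matching the indexing of [coord]. *)
pose Cn i := if insub i is Some j then C j else setT.
have mCn i : measurable (Cn i) by rewrite /Cn; case: insubP.
have rectE : rect (fun i : 'I_p => Cn i) = rect C.
  by rewrite /rect; apply/seteqP; split => y h i; have := h i; rewrite /Cn valK.
pose D := Y @^-1` rect C.
have mD : measurable D.
  rewrite (_ : D = \bigcap_(i : 'I_p) ((fun t => coord (Y t) i) @^-1` C i)).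
    by apply: fin_bigcap_measurable => // i _; rewrite -[X in measurable X]setTI; exact: mY.
  apply/seteqP; split => t h i.
    by move=> _; rewrite /= coord_ord; exact: h.
  by have := h i I; rewrite /= coord_ord.
have mUB : measurable (U @^-1` B) by rewrite -[X in measurable X]setTI; exact: mU.
have bD : bounded_measurable (\1_D : T -> R).
  by split; [exact: measurable_indic|exists 1 => t; exact: indic_norm_le1].
have key : Rintegral P setT (fun t => (\1_B (U t) - K t) * \1_D t) = 0.
  have := @rect0_of_cos0 _ _ _ P (fun i t => coord (Y t) i) mY p
    (fun t => \1_B (U t) - K t) (bmB bB bK) _ Cn mCn.
  move=> h; rewrite -[RHS]h.
    by apply: eq_Rintegral => t _; rewrite prod_indic_coord rectE.
  move=> al th; pose a : 'cV[R]_p := \col_j al (val j).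
  (* Since [om] is symmetric, [a . Y = a . xi + (om a) . W], so the frequency becomes [om *m a] and
     [a . xi] joins the phase. *)
  rewrite -[RHS](@cond_law_cos _ _ _ P p G de b eta U Z Gsym Gpos' eta0 Gb bde mU mZ lawU
    lawZ' indUZ B (om *m a) (dot a xi + th) mB).
  apply: eq_Rintegral => t _; congr (_ * cos _).
  transitivity (dot a (Y t) + th).
    by rewrite dotE; congr (_ + _); apply: eq_bigr => i _; rewrite col_of_coord.
  by rewrite /Y dotDr dot_mulmx omega_of_sym addrA (addrC (dot a xi)).
move: key; rewrite (_ : (fun t => _) = fun t => \1_B (U t) * \1_D t - K t * \1_D t); last first.
  by apply/funext => t; rewrite mulrBl.
rewrite bmRintegralB; [|exact: bmM|exact: bmM].
move=> /eqP; rewrite subr_eq0 => /eqP E0; have {E0} := congr1 (@EFin R) E0.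
rewrite !EFin_bmRintegral; [|exact: bmM|exact: bmM].
rewrite (_ : (fun t => (\1_B (U t) * \1_D t)%:E) =
    fun t => (\1_(U @^-1` B `&` D) t)%:E); last by apply/funext => t; rewrite indicI.
rewrite integral_indic//; last exact: measurableI.
rewrite setIT => ->; rewrite [RHS]integral_indicM; apply: eq_integral => t _.
by rewrite kernelE -EFinM mulrC.
Qed.
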